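(* Let $G$ be a finite simple graph on $n$ vertices with clique number $\omega$, and suppose $G$ is $(4K_1,\overline{P_3\cup P_2})$-free, i.e. $G$ contains no induced subgraph isomorphic to $4K_1$ and none isomorphic to the complement of $P_3\cup P_2$. Then $n\le 7\omega$ and $\chi(G)\le 4\omega$.
   Context: $4K_1$ is the edgeless graph on $4$ vertices; $P_n$ is the path on $n$ vertices; $H_1\cup H_2$ is the disjoint union; $\overline{H}$ is the complement of $H$. $\chi(G)$ is the chromatic number and $\omega$ the size of a largest clique of $G$. *)

(* Defs.v *)
From mathcomp Require Import all_boot.
Set Implicit Arguments. Unset Strict Implicit. Unset Printing Implicit Defensive.

Definition simple_graph (T : finType) (e : rel T) : Prop :=
  symmetric e /\ irreflexive e.

Definition has_induced (U T : finType) (h : rel U) (e : rel T) : Prop :=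
  exists f : U -> T, injective f /\ forall u v, e (f u) (f v) = h u v.

Definition fourK1 : rel 'I_4 := fun _ _ => false.

Definition P3uP2 : rel 'I_5 := fun u v =>
  let a := nat_of_ord u in let b := nat_of_ord v in
  [|| (a == 0) && (b == 1), (a == 1) && (b == 0), (a == 1) && (b == 2),
      (a == 2) && (b == 1), (a == 3) && (b == 4) | (a == 4) && (b == 3)].

Definition compl_graph (U : finType) (h : rel U) : rel U :=
  fun u v => (u != v) && ~~ h u v.

Definition coP3uP2 : rel 'I_5 := compl_graph P3uP2.

Definition is_clique (T : finType) (e : rel T) (S : {set T}) : bool :=
  [forall x in S, forall y in S, (x != y) ==> e x y].

Definition clique_number (T : finType) (e : rel T) : nat :=
  \max_(S : {set T} | is_clique e S) #|S|.

Definition colorable (T : finType) (e : rel T) (k : nat) : bool :=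
  [exists f : {ffun T -> 'I_k}, forall x, forall y, e x y ==> (f x != f y)].

(* Chromatic number: least k such that G is k-colourable
   (k = #|T| always works for a loopless graph, so the range suffices). *)
Definition chromatic_number (T : finType) (e : rel T) : nat :=
  \big[minn/#|T|]_(k < #|T|.+1 | colorable e k) k.

(* Main.v *)
Require Import Defs.
From mathcomp Require Import all_boot.
From mathcomp Require Import zify.

(* Fix pairwise nonadjacent a, b, c (without such a triple the bounds are easy).
   Let A be the vertices adjacent to neither b nor c, so that A is a clique
   containing a, and write A° for A minus a; define B and C likewise.  Every
   other vertex sees at least two of a, b, c.  Common neighbourhoods of
   nonadjacent vertices are complete multipartite.  If some triple is complete
   to a nonadjacent pair, then few vertices see exactly two of a, b, c.
   Otherwise nonadjacency is a matching in each common neighbourhood, and p, the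
   number of nonadjacent pairs seen by a and b but not by c, measures how far
   these vertices are from a clique.
   Every vertex of A° or B° sees exactly one vertex of each such pair.  Reading
   this as a binary pattern of length p, adjacent vertices on different sides
   differ in at most one place, vertices on the same side in at most two, and
   nonadjacent vertices on different sides are opposite.  So for p >= 4 the sets
   A° and B° are complete or anticomplete to each other, and for p = 3 mixed
   adjacency forces them to be tiny; in every case the loss caused by many pairs
   is compensated by the sizes of A, B and C. *)

Set Implicit Arguments.
Unset Strict Implicit.
Unset Printing Implicit Defensive.

(* Only the arithmetic facts in the conclusion are kept: lia is slow when it has
   to compare cardinals of sets up to conversion. *)
Ltac card_lia :=
  repeat match goal with |- context [card ?A] =>
    let n := fresh "n" in generalize (card A) => n end;
  repeat match goal with H : _ |- _ =>
    lazymatch type of H with nat => fail | _ => clear H end end;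
  lia.

(** * Hall's theorem *)

Section Hall.
Variables (T U : finType).
Implicit Types (A X : {set T}) (r : T -> U -> bool).

Definition nbhd r X := [set u | [exists x in X, r x u]].

Lemma nbhdP r X u : reflect (exists2 x, x \in X & r x u) (u \in nbhd r X).
Proof.
rewrite inE; apply: (iffP existsP) => [[x /andP[xX rxu]]|[x xX rxu]].
  by exists x.
by exists x; rewrite xX.
Qed.

Lemma hall (u0 : U) r A :
  (forall X, X \subset A -> #|X| <= #|nbhd r X|) ->
  exists f : T -> U, {in A &, injective f} /\ {in A, forall x, r x (f x)}.
Proof.
have [n] := ubnP #|A|; elim: n r A => // n IHn r A; rewrite ltnS => leAn hallA.
have [->|[a aA]] := set_0Vmem A.
  by exists (fun=> u0); split=> x; rewrite inE.
(* Either some proper nonempty subset is tight, and A splits along it, or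
   there is slack everywhere and a can be matched arbitrarily. *)
case: (boolP [exists X : {set T},
         [&& X \proper A, X != set0 & #|nbhd r X| == #|X|]]) => [|slack].
  case/existsP=> X /and3P[prX X0 /eqP tight].
  have sXA := proper_sub prX.
  have [|Y sYX|f [injf rf]] := IHn r X.
  - by apply: leq_trans leAn; apply: proper_card.
  - by apply: hallA; apply: subset_trans sXA.
  pose r' x u := r x u && (u \notin nbhd r X).
  have [|Y sY|g [injg rg]] := IHn r' (A :\: X).
  - apply: leq_trans leAn; apply: proper_card; rewrite properE subsetDl /=.
    case/set0Pn: X0 => x xX; apply/subsetPn; exists x; first exact: (subsetP sXA).
    by rewrite inE xX.
  - have dXY : [disjoint X & Y].
      rewrite disjoint_sym; apply/pred0P=> x /=; apply/negP=> /andP[/(subsetP sY)].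
      by rewrite inE => /andP[/negP nX _].
    have sXYA : X :|: Y \subset A.
      by rewrite subUset sXA (subset_trans sY) ?subsetDl.
    (* Hall's condition for [X :|: Y], with the tight part [X] cancelled, is the condition for [Y]
       under [r']. *)
    have := hallA _ sXYA.
    have -> : nbhd r (X :|: Y) = nbhd r X :|: nbhd r' Y.
      apply/setP=> u; rewrite in_setU; apply/nbhdP/orP.
        case=> x; rewrite inE => /orP[xX rxu|xY rxu]; first by left; apply/nbhdP; exists x.
        case: (boolP (u \in nbhd r X)) => [|nu]; first by left.
        by right; apply/nbhdP; exists x; rewrite // /r' rxu.
      case=> /nbhdP[x xX]; first by exists x; rewrite // inE xX.
      by case/andP=> rxu _; exists x; rewrite // inE xX orbT.
    have -> : #|X :|: Y| = #|X| + #|Y|.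
      by move/leqifP: (leq_card_setU X Y); rewrite dXY => /eqP.
    move=> h; have := leq_trans h (leq_card_setU _ _); rewrite tight.
    by rewrite leq_add2l.
  exists (fun x => if x \in X then f x else g x); split=> [x y|x].
    move=> xA yA /=.
    case: (boolP (x \in X)) => xX; case: (boolP (y \in X)) => yX.
    - exact: injf.
    - move=> Efg; have /andP[_ /negP[]] : r' y (g y) by apply: rg; rewrite inE yX.
      by rewrite -Efg; apply/nbhdP; exists x => //; apply: rf.
    - move=> Egf; have /andP[_ /negP[]] : r' x (g x) by apply: rg; rewrite inE xX.
      by rewrite Egf; apply/nbhdP; exists y => //; apply: rf.
    - by apply: injg; rewrite inE ?xX ?yX.
  move=> xA /=; case: (boolP (x \in X)) => xX; first exact: rf.
  by have /andP[] : r' x (g x) by apply: rg; rewrite inE xX.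
have [u rau] : exists u, r a u.
  have := hallA [set a]; rewrite sub1set cards1 => /(_ aA).
  by case/card_gt0P=> u /nbhdP[x /set1P->]; exists u.
pose r' x v := r x v && (v != u).
have [|Y sY|g [injg rg]] := IHn r' (A :\ a).
- by apply: leq_trans leAn; rewrite [X in _ < X](cardsD1 a) aA.
- have [->|Y0] := eqVneq Y set0; first by rewrite cards0.
  have prY : Y \proper A.
    by apply: (sub_proper_trans sY); rewrite properD1.
  have ltY : #|Y| < #|nbhd r Y|.
    rewrite ltn_neqAle hallA ?proper_sub // andbT eq_sym.
    apply: contra slack => tight; apply/existsP; exists Y.
    by rewrite prY Y0.
  have -> : nbhd r' Y = nbhd r Y :\ u.
    apply/setP=> v; rewrite in_setD1; apply/nbhdP/andP.
      by case=> x xY /andP[rxv vu]; split=> //; apply/nbhdP; exists x.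
    by case=> vu /nbhdP[x xY rxv]; exists x; rewrite // /r' rxv.
  by move: ltY; rewrite (cardsD1 u (nbhd r Y)); case: (u \in _); lia.
exists (fun x => if x == a then u else g x); split=> [x y xA yA|x xA] /=.
  have gu z : z \in A -> z != a -> g z != u.
    by move=> zA za; have /andP[] : r' z (g z) by apply: rg; rewrite !inE za.
  have [->|xa] := eqVneq x a; have [->|ya] := eqVneq y a => //.
  - by move=> E; move: (gu y yA ya); rewrite -E eqxx.
  - by move=> E; move: (gu x xA xa); rewrite E eqxx.
  - by apply: injg; rewrite !inE ?xa ?ya.
have [->//|xa] := eqVneq x a.
by have /andP[] : r' x (g x) by apply: rg; rewrite !inE xa.
Qed.

End Hall.

(** * Cliques and partial colourings *)

Section Coloring.
Variables (T : finType) (e : rel T).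
Hypotheses (esym : symmetric e) (eirr : irreflexive e).
Implicit Types (x y z : T) (S A B Q : {set T}).

Lemma cliqueP S : reflect {in S &, forall x y, x != y -> e x y} (is_clique e S).
Proof.
apply: (iffP forallP) => [h x y xS yS ne|h x].
  by have /implyP/(_ xS)/forallP/(_ y)/implyP/(_ yS)/implyP := h x; apply.
apply/implyP=> xS; apply/forallP=> y; apply/implyP=> yS.
by apply/implyP; apply: h.
Qed.

Lemma clique_bound S : is_clique e S -> #|S| <= clique_number e.
Proof. by move=> cS; rewrite /clique_number (bigD1 S) //= leq_maxl. Qed.

Lemma cliqueS S S' : S' \subset S -> is_clique e S -> is_clique e S'.
Proof.
move=> /subsetP sS /cliqueP cS; apply/cliqueP=> x y xS yS.
by apply: cS; apply: sS.
Qed.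

Lemma cliqueU S S' : is_clique e S -> is_clique e S' ->
  {in S & S', forall x y, x != y -> e x y} -> is_clique e (S :|: S').
Proof.
move=> /cliqueP cS /cliqueP cS' cSS'; apply/cliqueP=> x y.
rewrite !inE => /orP[xS|xS] /orP[yS|yS] ne; [exact: cS|exact: cSS'| |exact: cS'].
by rewrite esym; apply: cSS'; rewrite // eq_sym.
Qed.

Lemma cliqueU1 x S : is_clique e S -> {in S, forall y, x != y -> e x y} ->
  is_clique e (x |: S).
Proof.
move=> cS xS; apply: cliqueU => //; last by move=> _ y /set1P->; apply: xS.
by apply/cliqueP=> y z /set1P-> /set1P->; rewrite eqxx.
Qed.

(** Colours are plain numbers, so that two palettes can be joined by shifting one past the other. *)
Definition colorable_on S k := exists f : T -> nat,
  (forall x, x \in S -> f x < k) /\ {in S &, forall x y, e x y -> f x != f y}.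

Lemma colorable_on_img (C : finType) (Z : {set C}) (f : T -> C) S :
  {in S, forall x, f x \in Z} -> {in S &, forall x y, e x y -> f x != f y} ->
  colorable_on S #|Z|.
Proof.
move=> fZ fP; exists (fun x => index (f x) (enum Z)); split=> [x xS|x y xS yS exy].
  by rewrite cardE index_mem mem_enum fZ.
apply: contra (fP x y xS yS exy) => /eqP E.
rewrite -(nth_index (f x) (_ : f x \in enum Z)) ?mem_enum ?fZ // E.
by rewrite nth_index ?mem_enum ?fZ.
Qed.

Lemma colorable_onW S S' k k' : colorable_on S k -> S' \subset S -> k <= k' ->
  colorable_on S' k'.
Proof.
move=> [f [fk fP]] /subsetP sS lek; exists f; split=> [x /sS xS|x y /sS xS /sS yS].
  by apply: leq_trans lek; apply: fk.
exact: fP.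
Qed.

Lemma colorable_onU S S' k k' : colorable_on S k -> colorable_on S' k' ->
  colorable_on (S :|: S') (k + k').
Proof.
move=> [f [fk fP]] [g [gk gP]].
exists (fun x => if x \in S then f x else k + g x); split=> [x|x y].
  rewrite inE; case: (boolP (x \in S)) => xS /= h; last by rewrite ltn_add2l gk.
  by have := fk x xS; lia.
rewrite !inE; case: (boolP (x \in S)) => xS; case: (boolP (y \in S)) => yS /= hx hy exy.
- exact: fP.
- by have := fk x xS; lia.
- by have := fk y yS; lia.
- by rewrite eqn_add2l gP.
Qed.

Lemma colorable_on_card S : colorable_on S #|S|.
Proof.
apply: (@colorable_on_img _ _ id) => // x y _ _ exy.
by apply/eqP=> E; move: exy; rewrite E eirr.
Qed.

Lemma colorable_on_indep S : {in S &, forall x y, ~~ e x y} -> colorable_on S 1.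
Proof. by move=> h; exists (fun=> 0); split=> // x y xS yS; rewrite (negPf (h x y xS yS)). Qed.

(* The bipartite complement of two cliques is perfect (Koenig): Hall's
   theorem matches A into the non-neighbours in B and w - |B| spare colours. *)
Lemma colorable_on_cobipartite A B w : is_clique e A -> is_clique e B ->
  [disjoint A & B] -> (forall Q, Q \subset A :|: B -> is_clique e Q -> #|Q| <= w) ->
  colorable_on (A :|: B) w.
Proof.
move=> cA cB dAB bw.
have leB : #|B| <= w by apply: bw => //; apply: subsetUr.
have [->|[a aA]] := set_0Vmem A.
  by rewrite set0U; apply: (colorable_onW (colorable_on_card B)).
(* The palette: the vertices of [B], each coloured by itself, and [w - #|B|] spare colours. *)
pose U := (T + 'I_(w - #|B|))%type.
pose r x (u : U) := if u is inl b then (b \in B) && ~~ e x b else true.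
have [|f [injf rf]] := @hall T U (inl a) r A.
  move=> X sXA; pose Y := [set b in B | [forall x in X, e x b]].
  have [->|[x0 x0X]] := set_0Vmem X; first by rewrite cards0.
  have sYB : Y \subset B by apply/subsetP=> b; rewrite inE => /andP[].
  (* [Y] is what no vertex of [X] can share a colour with, so [w - #|Y|] colours are available to
     [X], and the clique bound becomes Hall's condition. *)
  have cXY : #|X :|: Y| <= w.
    apply: bw; first exact: setUSS.
    apply: cliqueU; [exact: cliqueS cA|exact: cliqueS cB|].
    by move=> x y xX; rewrite inE => /andP[_ /forallP/(_ x)]; rewrite xX.
  have dXY : #|X :|: Y| = #|X| + #|Y|.
    have /leqifP := leq_card_setU X Y; case: ifPn => [_ /eqP//|/negP[]].
    exact: disjointWl sXA (disjointWr sYB dAB).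
  have -> : nbhd r X = (inl @: (B :\: Y)) :|: (inr @: [set: 'I_(w - #|B|)]).
    apply/setP=> -[b|i]; rewrite in_setU; apply/nbhdP/orP.
    - case=> x xX /andP[bB nxb]; left; apply: imset_f; rewrite !inE bB andbT /=.
      by apply/forallPn; exists x; rewrite xX.
    - case=> /imsetP[b' b'Y E] //; case: E b'Y => <-; rewrite !inE andbC => /andP[bB].
      rewrite bB /= => /forallPn[x]; rewrite negb_imply => /andP[xX nx].
      by exists x; rewrite //= bB.
    - by move=> _; right; apply: imset_f; rewrite inE.
    - by move=> _; exists x0.
  have -> : #|inl @: (B :\: Y) :|: inr @: [set: 'I_(w - #|B|)]| =
            #|B :\: Y| + (w - #|B|) :> nat.
    have /leqifP := leq_card_setU ((inl : T -> U) @: (B :\: Y)) (inr @: [set: 'I_(w - #|B|)]).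
    case: ifPn => [_ /eqP->|/negP[]].
      by rewrite !card_imset ?cardsT ?card_ord // => ? ? [].
    by apply/pred0P=> -[b|i] /=; apply/negP=> /andP[/imsetP[? _ E] /imsetP[? _ E']].
  by have := cardsID Y B; rewrite (setIidPr sYB); lia.
have injr : injective (@inr T 'I_(w - #|B|)) by move=> ? ? [].
have injl : injective (@inl T 'I_(w - #|B|)) by move=> ? ? [].
pose Z : {set U} := inl @: B :|: inr @: [set: 'I_(w - #|B|)].
have cZ : #|Z| <= w.
  have := (leq_card_setU (inl @: B : {set U}) (inr @: [set: 'I_(w - #|B|)])).1.
  by rewrite -/Z (card_imset _ injl) (card_imset _ injr) cardsT card_ord; lia.
apply: (@colorable_onW (A :|: B) _ #|Z|) => //.
apply: (@colorable_on_img _ _ (fun x => if x \in A then f x else inl x)) => [x|x y].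
  rewrite inE; case: (boolP (x \in A)) => xA /= xB.
    have := rf x xA; case: (f x) => [b /andP[bB _]|i _]; rewrite inE.
      by rewrite imset_f.
    by rewrite [_ \in inr @: _]imset_f ?inE // orbT.
  by rewrite inE imset_f.
rewrite !inE; case: (boolP (x \in A)) => xA; case: (boolP (y \in A)) => yA /= hx hy exy.
- by apply/eqP=> /(injf _ _ xA yA) E; rewrite E eirr in exy.
- by apply/eqP=> E; have := rf x xA; rewrite E /r exy andbF.
- by apply/eqP=> E; have := rf y yA; rewrite -E /r esym exy andbF.
- by apply/eqP=> /injl E; rewrite E eirr in exy.
Qed.

Lemma colorable_onP k : colorable_on [set: T] k -> colorable e k.
Proof.
case=> f [fk fP]; apply/existsP.
have lt x : f x < k by apply: fk; rewrite inE.
exists [ffun x => Ordinal (lt x)]; apply/forallP=> x; apply/forallP=> y.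
by apply/implyP=> exy; rewrite !ffunE -val_eqE /= fP ?inE.
Qed.

Lemma chromatic_number_le k : colorable_on [set: T] k -> chromatic_number e <= k.
Proof.
move=> /colorable_onP ck; rewrite /chromatic_number.
have idx (m : nat) (P : pred 'I_m) :
    \big[minn/#|T|]_(i < m | P i) nat_of_ord i <= #|T|.
  by elim/big_rec: _ => // i x _; apply: leq_trans (geq_minr _ _).
(* Above [#|T|] the default value of the minimum is already small enough. *)
have [lek|] := leqP k #|T|; last by move/ltnW; apply: leq_trans (idx _ _).
have: Ordinal (lek : k < #|T|.+1) \in index_enum _ by rewrite mem_index_enum.
elim: (index_enum _) => // i r IHr; rewrite inE big_cons => /predU1P[<-|/IHr le_r].
  by rewrite ck; apply: geq_minl.
by case: ifP => // _; apply: leq_trans (geq_minr _ _) le_r.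
Qed.

End Coloring.

(** * Complete multipartite sets *)

Section Multipartite.
Variables (T : finType) (e : rel T).
Hypotheses (esym : symmetric e) (eirr : irreflexive e).
Implicit Types (x y z : T) (S Q X : {set T}).
Local Notation na := (compl_graph e).
Local Notation w := (clique_number e).

Lemma na_sym x y : na x y = na y x.
Proof. by rewrite /compl_graph eq_sym esym. Qed.

Definition top S := [arg max_(Q > set0 | (Q \subset S) && is_clique e Q) #|Q|].

Lemma topP S : [/\ top S \subset S, is_clique e (top S) &
  forall Q, Q \subset S -> is_clique e Q -> #|Q| <= #|top S|].
Proof.
rewrite /top; case: arg_maxnP => [|Q /andP[sQ cQ] maxQ].
  by rewrite sub0set; apply/cliqueP=> x y; rewrite inE.
by split=> // Q' sQ' cQ'; apply: maxQ; rewrite sQ'.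
Qed.

Lemma top_na S x : x \in S -> x \notin top S -> exists2 y, y \in top S & na x y.
Proof.
move=> xS xQ; have [sQ cQ maxQ] := topP S.
have [y /andP[yQ nxy]|h] := pickP (fun y => (y \in top S) && na x y); first by exists y.
have: #|x |: top S| <= #|top S|.
  apply: maxQ; first by rewrite subUset sub1set xS.
  apply: cliqueU1 => // y yQ ne; have := h y.
  by rewrite yQ /compl_graph ne /= => /negbFE.
by rewrite cardsU1 xQ; lia.
Qed.

Lemma top_bound S a : {in S, forall x, e x a} -> #|top S| < w.
Proof.
move=> aS; have [/subsetP sQ cQ _] := topP S.
have aQ : a \notin top S by apply/negP=> /sQ/aS; rewrite eirr.
have := cardsU1 a (top S); rewrite aQ add1n => <-.
by apply: clique_bound; apply: cliqueU1 => // y /sQ/aS; rewrite esym.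
Qed.

Section NonadjacencyTransitive.
Variable S : {set T}.
Hypothesis natr : {in S & &, forall x y z, ~~ e x y -> ~~ e y z -> ~~ e x z}.

(** The representative in [top S] of the part of [x]. The default [x] is the right value when [x]
    itself lies in the clique [top S], where it has no non-neighbour. *)
Definition part x := odflt x [pick y in top S | na x y].

Lemma partP x : x \in S -> part x \in top S /\ ~~ e x (part x).
Proof.
move=> xS; rewrite /part; case: pickP => [y /andP[yQ /andP[_ nxy]]|h] //=.
rewrite eirr; split=> //; apply: contraT => xQ.
by have [y yQ nxy] := top_na xS xQ; have := h y; rewrite yQ nxy.
Qed.

Lemma colorable_on_multipartite : colorable_on e S #|top S|.
Proof.
have [/subsetP sQ _ _] := topP S.
apply: (colorable_on_img (f := part)) => [x /partP[]//|x y xS yS exy].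
apply/eqP=> E; have [px nx] := partP xS; have [_ ny] := partP yS.
by move: exy; apply/negP; apply: natr nx _; rewrite ?(sQ _ px) // E esym.
Qed.

Lemma card_multipartite k :
  (forall X, X \subset S -> {in X &, forall x y, ~~ e x y} -> #|X| <= k) ->
  #|S| <= k * #|top S|.
Proof.
move=> indk; rewrite -sum1_card (partition_big part (mem (top S))) /=; last first.
  by move=> x /partP[].
rewrite mulnC -sum_nat_const; apply: leq_sum => q qQ.
have -> : \sum_(i in S | part i == q) 1 = #|[set i in S | part i == q]|.
  by rewrite -sum1_card; apply: eq_bigl => i; rewrite inE.
apply: indk; first by apply/subsetP=> x; rewrite inE => /andP[].
have [/subsetP sQ _ _] := topP S.
move=> x y; rewrite !inE => /andP[xS /eqP px] /andP[yS /eqP py].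
have [_ nx] := partP xS; have [_ ny] := partP yS.
rewrite px in nx; rewrite py in ny.
by apply: (natr xS (sQ q qQ) yS nx); rewrite esym.
Qed.

End NonadjacencyTransitive.

(** * Sets where non-adjacency is a matching *)

Section Matched.
Variable S : {set T}.
Hypothesis matched : {in S & &, forall x y z, na x y -> na x z -> y = z}.

Definition paired := [set x in S | [exists y in S, na x y]].
Definition npairs := #|paired|./2.
Definition mate x := odflt x [pick y in S | na x y].

Lemma pairedP x : x \in paired -> [/\ x \in S, mate x \in S & na x (mate x)].
Proof.
rewrite inE => /andP[xS /existsP[y /andP[yS nxy]]].
rewrite /mate; case: pickP => [z /andP[zS nxz]//|/(_ y)].
by rewrite yS nxy.
Qed.

Lemma mateE x y : x \in S -> y \in S -> na x y -> x \in paired /\ y = mate x.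
Proof.
move=> xS yS nxy.
have xP : x \in paired by rewrite inE xS; apply/existsP; exists y; rewrite yS.
by have [_ mS nxm] := pairedP xP; split=> //; apply: matched nxy nxm.
Qed.

Lemma mate_paired x : x \in paired -> mate x \in paired /\ mate (mate x) = x.
Proof.
move=> xP; have [xS mS nxm] := pairedP xP.
by move: nxm; rewrite na_sym => /(mateE mS xS)[].
Qed.

(** Such an [X] picks one end of each pair: [mate] maps it bijectively onto the rest of [paired]. *)
Lemma card_half X : X \subset paired ->
  {in paired, forall x, (mate x \in X) = (x \notin X)} -> #|X| = npairs.
Proof.
move=> sX hX.
have E : paired :\: X = mate @: X.
  apply/setP=> x; rewrite inE; apply/andP/imsetP.
    case=> xX xP; have [mP mm] := mate_paired xP.
    by exists (mate x); rewrite ?mm // hX.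
  case=> y yX ->; have yP := subsetP sX y yX; have [mP mm] := mate_paired yP.
  by split=> //; rewrite hX // yX.
have := cardsID X paired; rewrite (setIidPr sX) E card_in_imset => [|x y xX yX E'].
  by rewrite /npairs => <-; rewrite addnn doubleK.
have [_ mx] := mate_paired (subsetP sX x xX).
by have [_ my] := mate_paired (subsetP sX y yX); rewrite -mx E' my.
Qed.

Lemma matched_natr : {in S & &, forall x y z, ~~ e x y -> ~~ e y z -> ~~ e x z}.
Proof.
move=> x y z xS yS zS nxy nyz.
have [->//|xy] := eqVneq x y.
have [yz|yz] := eqVneq y z; first by rewrite -yz.
have nyx : na y x by rewrite /compl_graph eq_sym xy esym.
by rewrite (matched yS xS zS nyx _) ?eirr // /compl_graph yz.
Qed.

Lemma rest_clique : is_clique e (S :\: top S).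
Proof.
have [/subsetP sQ _ _] := topP S.
apply/cliqueP=> x y; rewrite !inE => /andP[xQ xS] /andP[yQ yS] ne.
apply: contraT => nxy; have [z zQ nxz] := top_na xS xQ.
have E : y = z by apply: (matched xS yS (sQ z zQ)); rewrite // /compl_graph ne.
by rewrite E zQ in yQ.
Qed.

(** A largest clique contains exactly one end of each pair and every unpaired vertex: whatever lies
    outside it has its mate inside. *)
Lemma card_rest : #|S :\: top S| = npairs.
Proof.
have [/subsetP sQ /cliqueP cQ _] := topP S.
apply: card_half => [|x xP].
  apply/subsetP=> x; rewrite inE => /andP[xQ xS].
  by have [y /sQ yS nxy] := top_na xS xQ; have [] := mateE xS yS nxy.
have [xS mS nxm] := pairedP xP; rewrite !inE mS xS !andbT negbK.
apply/idP/idP => [mQ|xQ]; last first.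
  apply/negP=> mQ; case/andP: nxm => ne /negP[].
  exact: cQ.
apply: contraT => xQ; have [y yQ nxy] := top_na xS xQ.
by have [_ E] := mateE xS (sQ y yQ) nxy; rewrite -E yQ in mQ.
Qed.

Lemma card_matched : #|S| = #|top S| + npairs.
Proof.
have [sQ _ _] := topP S.
by rewrite -(cardsID (top S) S) (setIidPr sQ) card_rest.
Qed.

End Matched.

End Multipartite.

(** * Partition around an independent triple *)

Section Triples.
Variables (T : finType) (e : rel T).
Hypotheses (esym : symmetric e) (eirr : irreflexive e).
Implicit Types (a b c t x y z : T) (S Q X : {set T}).
Local Notation na := (compl_graph e).
Local Notation w := (clique_number e).

Hypothesis alpha3 : forall x y z t,
  na x y -> na x z -> na x t -> na y z -> na y t -> na z t -> False.
Hypothesis coP3uP2_free : forall a b x y z, na a b ->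
  e x a -> e x b -> e y a -> e y b -> e z a -> e z b -> e y z -> na x y -> e x z.

(* priv b c is A, and priv b c :\ a is A°; later, npairs e (duo a b c) is p. *)
Definition common a b := [set x | e x a && e x b].
Definition priv b c := [set x | na x b && na x c].
Definition duo a b c := [set x | [&& e x a, e x b & ~~ e x c]].
Definition trio a b c := [set x | [&& e x a, e x b & e x c]].

Lemma duoC a b c : duo a b c = duo b a c.
Proof. by apply/setP=> x; rewrite !inE andbCA. Qed.

Lemma privC b c : priv b c = priv c b.
Proof. by apply/setP=> x; rewrite !inE andbC. Qed.

(** If [x z] were an edge, the complement would have the path x - y - z and, apart from it, the edge
    [a b]: the five vertices would induce the forbidden graph. *)
Lemma common_natr a b : na a b ->
  {in common a b & &, forall x y z, ~~ e x y -> ~~ e y z -> ~~ e x z}.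
Proof.
move=> nab x y z; rewrite !inE => /andP[xa xb] /andP[ya yb] /andP[za zb] nxy nyz.
have [->//|xy] := eqVneq x y.
apply: contra nyz => exz; apply: (coP3uP2_free nab) exz _ => //.
by rewrite /compl_graph eq_sym xy esym.
Qed.

Lemma top_common a b : #|top e (common a b)| < w.
Proof. by apply: (top_bound esym eirr (a := a)) => x; rewrite inE => /andP[]. Qed.

Lemma colorable_on_common a b : na a b -> colorable_on e (common a b) w.-1.
Proof.
move=> nab; have := top_common a b.
have := colorable_on_multipartite esym eirr (common_natr nab).
by move=> h ltw; apply: colorable_onW h _ _ => //; lia.
Qed.

Lemma priv_clique b c : na b c -> is_clique e (priv b c).
Proof.
move=> nbc; apply/cliqueP=> x y; rewrite !inE => /andP[xb xc] /andP[yb yc] ne.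
by apply: contraT => nxy; case: (@alpha3 x y b c) => //; rewrite /compl_graph ne.
Qed.

Lemma triple_cover a b c x : na a b -> na a c -> na b c ->
  [|| x \in priv b c, x \in priv a c, x \in priv a b, x \in duo a b c,
      x \in duo a c b, x \in duo b c a | x \in trio a b c].
Proof.
move=> nab nac nbc; rewrite !inE.
have [->|xa] := eqVneq x a; first by rewrite nab nac.
have [->|xb] := eqVneq x b; first by rewrite [na b a]na_sym // nab nbc orbT.
have [->|xc] := eqVneq x c.
  by rewrite [na c a]na_sym // [na c b]na_sym // nac nbc !orbT.
have: ~~ [&& ~~ e x a, ~~ e x b & ~~ e x c].
  apply/negP=> /and3P[nxa nxb nxc].
  by case: (@alpha3 x a b c) => //; rewrite /compl_graph ?xa ?xb ?xc.
rewrite /compl_graph xa xb xc /=.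
by case: (e x a); case: (e x b); case: (e x c).
Qed.

Lemma card_le2 S : (forall x y z, x \in S -> y \in S -> z \in S ->
    x != y -> y != z -> z != x -> False) -> #|S| <= 2.
Proof.
move=> h; rewrite leqNgt; apply/negP=> /card_gt2P[x [y [z [[xS yS zS] [xy yz zx]]]]].
exact: h xy yz zx.
Qed.

Lemma indep_le3 X : {in X &, forall x y, ~~ e x y} -> #|X| <= 3.
Proof.
move=> indX; have [->|[t tX]] := set_0Vmem X; first by rewrite cards0.
rewrite (cardsD1 t) tX ltnS.
apply: card_le2 => x y z; rewrite !inE => /andP[xt xX] /andP[yt yX] /andP[zt zX] xy yz zx.
case: (@alpha3 x y z t); rewrite /compl_graph indX ?andbT //.
by rewrite eq_sym.
Qed.

(** ** Independence number at most two *)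

(** The non-neighbours of [a] and those of [b] form cliques, and the parts of [common a b] have at
    most two vertices. This gives at most [4w - 2] vertices and [3w - 1] colours. *)
Lemma alpha2_bounds a b : na a b ->
  (forall x y z, na x y -> na x z -> na y z -> False) ->
  #|T| <= 7 * w /\ colorable_on e [set: T] (4 * w).
Proof.
move=> nab alpha2.
pose A := [set x | na x b]; pose B := [set x | na x a].
have cl t : is_clique e [set x | na x t].
  apply/cliqueP=> x y; rewrite !inE => xt yt ne; apply: contraT => nxy.
  by case: (@alpha2 x y t); rewrite // /compl_graph ne.
have sub : [set: T] \subset A :|: B :|: common a b.
  apply/subsetP=> x _; rewrite !inE.
  have [->|xb] := eqVneq x b; first by rewrite [na b a]na_sym // nab orbT.
  have [->|xa] := eqVneq x a; first by rewrite nab.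
  by rewrite /compl_graph xa xb /=; case: (e x a); case: (e x b).
have ltw := top_common a b.
have card2 : #|common a b| <= 2 * #|top e (common a b)|.
  apply: card_multipartite => //; first exact: common_natr.
  move=> X _ indX; apply: card_le2 => x y z xX yX zX xy yz zx.
  case: (@alpha2 x y z); rewrite /compl_graph indX ?andbT //.
  by rewrite eq_sym.
have cA := clique_bound (cl b); have cB := clique_bound (cl a).
split.
  have := subset_leq_card sub; rewrite cardsT.
  have := (leq_card_setU (A :|: B) (common a b)).1.
  have := (leq_card_setU A B).1.
  by rewrite -/A in cA; rewrite -/B in cB; lia.
have := colorable_onU (colorable_onU (colorable_on_card eirr A) (colorable_on_card eirr B))
  (colorable_on_common nab).
move/colorable_onW; apply=> //.
by rewrite -/A in cA; rewrite -/B in cB; lia.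
Qed.

(** ** An independent triple complete to a nonadjacent pair *)

Section K23.
Variables (a b c t s : T).
Hypotheses (nab : na a b) (nac : na a c).
Hypotheses (tT : t \in trio a b c) (sT : s \in trio a b c) (nts : na t s).

(** A vertex of the duo sees both or neither of [t] and [s], as non-adjacency is transitive in
    [common a b]. Seeing both would put it into [common t s] with [a] and [c], where it is adjacent
    to [a] only. So two distinct vertices of the duo would be independent together with [t] and
    [s]. *)
Lemma duo_le1 x y : x \in duo a b c -> y \in duo a b c -> x = y.
Proof.
move=> xD yD; move: (tT) (sT); rewrite !inE => /and3P[ta tb tc] /and3P[sa sb sc].
have uts u : u \in duo a b c -> na u t /\ na u s.
  rewrite inE => /and3P[ua ub nuc].
  have ut : u != t by apply: contraNneq nuc => ->.
  have us : u != s by apply: contraNneq nuc => ->.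
  have tr := common_natr nab.
  have uC : u \in common a b by rewrite inE ua ub.
  have tC : t \in common a b by rewrite inE ta tb.
  have sC : s \in common a b by rewrite inE sa sb.
  have nts' : ~~ e t s by case/andP: nts.
  have nst' : ~~ e s t by rewrite esym.
  rewrite /compl_graph ut us /=.
  case: (boolP (e u t)) => eut; last by split=> //; apply: tr eut nts'.
  case: (boolP (e u s)) => eus; last by have := tr _ _ _ uC sC tC eus nst'; rewrite eut.
  have : e c u.
    apply: (coP3uP2_free nts (y := a)); rewrite // ?[e a _]esym ?[e c _]esym //.
    by rewrite na_sym.
  by rewrite esym (negPf nuc).
apply/eqP; apply: contraT => xy.
have [nxt nxs] := uts x xD; have [nyt nys] := uts y yD.
move: xD yD; rewrite !inE => /and3P[xa xb nxc] /and3P[ya yb nyc].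
case: (@alpha3 x y t s) => //; rewrite /compl_graph xy /=.
apply: (common_natr nab (y := t)); rewrite ?inE ?xa ?xb ?ya ?yb ?ta ?tb //.
  by case/andP: nxt.
by rewrite esym; case/andP: nyt.
Qed.

End K23.

Lemma colorable_on_absorb Q S q : q \in Q -> {in S, forall x, ~~ e x q} ->
  {in S &, forall x y, x = y} -> colorable_on e (Q :|: S) #|Q|.
Proof.
move=> qQ Sq S1.
apply: (colorable_on_img (f := fun x => if x \in S then q else x)) => [x|x y].
  by rewrite inE; case: ifP => // _; rewrite orbF.
rewrite !inE; case: (boolP (x \in S)) => xS; case: (boolP (y \in S)) => yS hx hy exy.
- by rewrite (S1 x y) // eirr in exy.
- by apply: contraTneq exy => <-; apply: Sq.
- by apply: contraTneq exy => ->; rewrite esym; apply: Sq.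
- by apply: contraTneq exy => ->; rewrite eirr.
Qed.

(** Each duo has at most one vertex. The rest is covered by three cliques and a common neighbourhood
    with parts of size at most 3. In the colouring, the vertex seeing only [b] and [c] reuses the
    colour of [a], and so on, so the duos cost nothing. *)
Lemma K23_bounds a b c t s : na a b -> na a c -> na b c ->
  t \in trio a b c -> s \in trio a b c -> na t s ->
  #|T| <= 7 * w /\ colorable_on e [set: T] (4 * w).
Proof.
move=> nab nac nbc tT sT nts.
have trioC x y z : trio x y z = trio x z y.
  by apply/setP=> v; rewrite !inE; congr andb; rewrite andbC.
have trioR x y z : trio x y z = trio y z x.
  by apply/setP=> v; rewrite !inE andbC andbA.
have Dab : {in duo a b c &, forall x y, x = y} by move=> x y xD yD; apply: (@duo_le1 a b c t s).
have Dac : {in duo a c b &, forall x y, x = y}.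
  by move=> x y xD yD; apply: (@duo_le1 a c b t s); rewrite // ?[na c b]na_sym // trioC.
have Dbc : {in duo b c a &, forall x y, x = y}.
  by move=> x y xD yD; apply: (@duo_le1 b c a t s);
    rewrite // ?[na c a]na_sym ?[na b a]na_sym // -trioR.
have sub : [set: T] \subset ((priv b c :|: duo b c a) :|: (priv a c :|: duo a c b))
    :|: ((priv a b :|: duo a b c) :|: common a b).
  apply/subsetP=> x _; have := triple_cover x nab nac nbc; rewrite !in_setU.
  case: (x \in priv b c) => //; case: (x \in priv a c); rewrite ?orbT //.
  case: (x \in priv a b); rewrite ?orbT //; case: (x \in duo b c a); rewrite ?orbT //.
  case: (x \in duo a c b); rewrite ?orbT //; case: (x \in duo a b c); rewrite ?orbT //=.
  by rewrite !inE => /and3P[-> ->].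
have cA := clique_bound (priv_clique nbc); have cB := clique_bound (priv_clique nac).
have cC := clique_bound (priv_clique nab).
have ltw := top_common a b.
have cT : #|common a b| <= 3 * #|top e (common a b)|.
  apply: card_multipartite => //; first exact: common_natr.
  by move=> X _; apply: indep_le3.
have le1 S : {in S &, forall x y, x = y} -> #|S| <= 1.
  by move=> S1; apply/card_le1_eqP=> x y xS yS; apply: S1.
have := (le1 _ Dab, le1 _ Dac, le1 _ Dbc) => -[[l1 l2] l3].
split.
  have := subset_leq_card sub; rewrite cardsT.
  have := (leq_card_setU ((priv b c :|: duo b c a) :|: (priv a c :|: duo a c b))
    ((priv a b :|: duo a b c) :|: common a b)).1.
  have := (leq_card_setU (priv b c :|: duo b c a) (priv a c :|: duo a c b)).1.
  have := (leq_card_setU (priv a b :|: duo a b c) (common a b)).1.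
  have := (leq_card_setU (priv a b) (duo a b c)).1.
  have := (leq_card_setU (priv a c) (duo a c b)).1.
  have := (leq_card_setU (priv b c) (duo b c a)).1.
  lia.
have absorb x y z : na x z -> na y z -> {in duo x y z &, forall u v, u = v} -> na x y ->
    z \in priv x y -> colorable_on e (priv x y :|: duo x y z) #|priv x y|.
  move=> nxz nyz D1 nxy zp; apply: (colorable_on_absorb zp) => // u.
  by rewrite inE => /and3P[].
have pa : a \in priv b c by rewrite inE nab.
have pb : b \in priv a c by rewrite inE na_sym // nab.
have pc : c \in priv a b by rewrite inE ![na c _]na_sym // nac.
have h1 : colorable_on e (priv b c :|: duo b c a) #|priv b c|.
  by apply: absorb; rewrite // na_sym.
have h2 : colorable_on e (priv a c :|: duo a c b) #|priv a c|.
  by apply: absorb; rewrite // na_sym.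
have h3 : colorable_on e (priv a b :|: duo a b c) #|priv a b| by apply: absorb.
have := colorable_onU (colorable_onU h1 h2) (colorable_onU h3 (colorable_on_common nab)).
by move/colorable_onW; apply=> //; move: cA cB cC ltw; card_lia.
Qed.

End Triples.

(** * Matched common neighbourhoods *)

Section Matching.
Variables (T : finType) (e : rel T).
Hypotheses (esym : symmetric e) (eirr : irreflexive e).
Implicit Types (a b c t u v x y z : T) (S Q X : {set T}).
Local Notation na := (compl_graph e).
Local Notation w := (clique_number e).

Hypothesis alpha3 : forall x y z t,
  na x y -> na x z -> na x t -> na y z -> na y t -> na z t -> False.
Hypothesis matching : forall a b x y z, na a b ->
  e x a -> e x b -> e y a -> e y b -> e z a -> e z b -> na x y -> na x z -> y = z.

Lemma neq_edge x y z : e x z -> ~~ e y z -> x != y.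
Proof. by move=> exz; apply: contraNneq => <-. Qed.

Ltac edge := solve [assumption | rewrite esym; assumption].
Ltac neq := match goal with |- is_true (?x != ?y) =>
  first [ assumption | rewrite eq_sym; assumption |
  match goal with
  | H : is_true (e x ?z) |- _ => apply: (@neq_edge x y z); edge
  | H : is_true (e ?z x) |- _ => apply: (@neq_edge x y z); edge
  | H : is_true (e y ?z) |- _ => rewrite eq_sym; apply: (@neq_edge y x z); edge
  | H : is_true (e ?z y) |- _ => rewrite eq_sym; apply: (@neq_edge y x z); edge
  end ] end.
Ltac split_na := repeat match goal with
  H : is_true (compl_graph e ?x ?y) |- _ =>
    lazymatch goal with
    | _ : is_true (~~ e x y) |- _ => fail
    | _ => case/andP: (H) => ? ?
    end end.
Ltac nadj := first [assumption | rewrite na_sym; assumption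
  | apply/andP; split; [neq | edge]].
Ltac adj := solve [edge | nadj].
Ltac indep4 x y z t := exfalso; apply: (@alpha3 x y z t); nadj.

Lemma clique_lt Q a : is_clique e Q -> {in Q, forall x, e x a} -> #|Q| < w.
Proof.
move=> cQ aQ; have nQ : a \notin Q by apply/negP=> /aQ; rewrite eirr.
have := cardsU1 a Q; rewrite nQ add1n => <-.
by apply: clique_bound; apply: cliqueU1 => // y /aQ; rewrite esym.
Qed.

Lemma cardsU_disjoint Q X : [disjoint Q & X] -> #|Q :|: X| = #|Q| + #|X|.
Proof. by have /leqifP := leq_card_setU Q X; case: ifP => // _ /eqP. Qed.

Lemma duoP a b c x : x \in duo e a b c -> [/\ e x a, e x b & ~~ e x c].
Proof. by rewrite inE => /and3P[]. Qed.

Lemma duo_matched a b c : na a b ->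
  {in duo e a b c & &, forall x y z, na x y -> na x z -> y = z}.
Proof.
move=> nab x y z /duoP[xa xb _] /duoP[ya yb _] /duoP[za zb _].
exact: matching nab xa xb ya yb za zb.
Qed.

Lemma privP a b c u : na a b -> na a c -> na b c -> u \in priv e b c :\ a ->
  [/\ e u a, na u b & na u c].
Proof.
move=> nab nac nbc; rewrite !inE => /and3P[ua nub nuc]; split=> //.
by apply: contraT => nua; split_na; indep4 u a b c.
Qed.

(** If [u] sees both, then [a] and [u] are two non-neighbours of [b] in [common e x y]; if it sees
    neither, then [u], [x], [y], [c] are independent. *)
Lemma split_pair a b c u x y : na a b -> na a c -> na b c ->
  u \in priv e b c :\ a -> x \in duo e a b c -> y \in duo e a b c -> na x y ->
  e u x = ~~ e u y.
Proof.
move=> nab nac nbc uA /duoP[xa xb nxc] /duoP[ya yb nyc] nxy.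
have [ua nub nuc] := privP nab nac nbc uA.
apply/idP/idP => [ux|nuy].
  apply/negP=> uy; have E : a = u.
    apply: (matching nxy (x := b)); split_na; adj.
  by rewrite E eirr in ua.
by apply: contraT => nux; split_na; indep4 u x y c.
Qed.

Lemma split_pair' a b c v x y : na a b -> na a c -> na b c ->
  v \in priv e a c :\ b -> x \in duo e a b c -> y \in duo e a b c -> na x y ->
  e v x = ~~ e v y.
Proof.
move=> nab nac nbc; rewrite [duo e a b c]duoC.
by apply: split_pair; rewrite // na_sym.
Qed.

Lemma card_duo a b c : na a b ->
  #|duo e a b c| = #|top e (duo e a b c)| + npairs e (duo e a b c).
Proof. by move=> nab; apply: card_matched => //; apply: duo_matched. Qed.

Lemma top_duo_lt a b c : #|top e (duo e a b c)| < w.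
Proof. by apply: (top_bound esym eirr (a := a)) => x /duoP[]. Qed.

(** For two nonadjacent members, [b] and [c] would be two non-neighbours of [a] among their common
    neighbours. *)
Lemma trio_clique a b c : na a b -> na a c -> na b c -> is_clique e (trio e a b c).
Proof.
move=> nab nac nbc; apply/cliqueP=> x y; rewrite !inE => /and3P[xa xb xc] /and3P[ya yb yc] ne.
apply: contraT => nxy; have nxy' : na x y by apply/andP.
have E : b = c by apply: (matching nxy' (x := a)); adj.
by case/andP: nbc; rewrite E eqxx.
Qed.

Lemma card_trio a b c : na a b -> na a c -> na b c ->
  #|trio e a b c| + npairs e (duo e a b c) < w.
Proof.
move=> nab nac nbc; have mS := duo_matched (c := c) nab.
rewrite -(card_rest esym mS) -cardsU_disjoint; last first.
  apply/pred0P=> x /=; apply/negP=> /andP[]; rewrite !inE.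
  by case/and3P=> _ _ xc; rewrite xc !andbF.
apply: (@clique_lt _ a); last first.
  by move=> x; rewrite !inE => /orP[/and3P[]//|/and3P[_ ->]].
apply: cliqueU => //; [exact: trio_clique|exact: (rest_clique esym mS)|].
move=> t r; rewrite inE => /and3P[ta tb tc] /setDP[rS rQ] ne.
apply: contraT => ntr; have [s sQ nrs] := top_na esym rS rQ.
have [/subsetP sub _ _] := topP e (duo e a b c).
have [ra rb nrc] := duoP rS; have [sa sb nsc] := duoP (sub s sQ).
(* [t] and [s] would be two non-neighbours of [r] in [common e a b]. *)
have E : t = s by apply: (matching nab (x := r)); rewrite // /compl_graph eq_sym ne esym.
by rewrite E (negPf nsc) in tc.
Qed.

(** For [S] the duo of [a] and [b], and [v] in A° or B°, this contains one end of each pair and so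
    encodes the binary pattern of [v]. *)
Definition seen S v := paired e S :&: [set x | e v x].

Lemma seenE S v x : (x \in seen S v) = (x \in paired e S) && e v x.
Proof. by rewrite /seen in_setI [x \in [set _ | _]]inE. Qed.

(** ** A nonadjacent pair of private neighbours *)

Section NonadjacentPair.
Variables a b c u v : T.
Hypotheses (nab : na a b) (nac : na a c) (nbc : na b c).
Hypotheses (uA : u \in priv e b c :\ a) (vB : v \in priv e a c :\ b) (nuv : ~~ e u v).
Local Notation S := (duo e a b c).
Local Notation X := (seen S v).
Local Notation m := (mate e S).

Let nba : na b a. Proof. by rewrite na_sym. Qed.
Let mS := duo_matched (c := c) nab.

Lemma privBP z : z \in priv e a c :\ b -> [/\ e z b, na z a & na z c].
Proof. exact: privP. Qed.

Lemma card_seen : #|X| = npairs e S.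
Proof.
apply: (card_half esym mS) => [|x xP]; first exact: subsetIl.
have [xS mxS nxm] := pairedP xP; have [mP _] := mate_paired esym mS xP.
by rewrite !seenE mP xP (split_pair' nab nac nbc vB xS mxS nxm) negbK.
Qed.

(** The patterns of [u] and [v] are opposite: an end of a pair missed by both would be independent
    together with [u], [v] and [c]. *)
Lemma seenP x : x \in X -> [/\ [/\ e x a, e x b & ~~ e x c],
  [/\ e (m x) a, e (m x) b & ~~ e (m x) c], na x (m x),
  e v x /\ ~~ e v (m x) & ~~ e u x /\ e u (m x)].
Proof.
rewrite seenE => /andP[xP vx]; have [xS mxS nxm] := pairedP xP.
have [xa xb nxc] := duoP xS; have [ya yb nyc] := duoP mxS.
have [ua nub nuc] := privP nab nac nbc uA; have [vb nva nvc] := privBP vB.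
have nvy : ~~ e v (m x) by rewrite -(split_pair' nab nac nbc vB xS mxS nxm).
have uy : e u (m x).
  by apply: contraT => nuy; split_na; indep4 u v (m x) c.
have nux : ~~ e u x by rewrite (split_pair nab nac nbc uA xS mxS nxm) uy.
by split.
Qed.

Lemma mate_inj_seen x y : x \in X -> y \in X -> m x = m y -> x = y.
Proof.
rewrite !seenE => /andP[xP _] /andP[yP _] E.
have [_ mx] := mate_paired esym mS xP; have [_ my] := mate_paired esym mS yP.
by rewrite -mx E my.
Qed.

(** Like [v], the vertex [z] is nonadjacent to [u], so its pattern is opposite to that of [u] and
    equal to that of [v]. *)
Lemma opposite_side z x : z \in priv e a c :\ b -> ~~ e z u -> x \in X ->
  e z x /\ ~~ e z (m x).
Proof.
move=> zB nzu xX; have [[xa xb nxc] [ya yb nyc] nxm [vx nvm] [nux um]] := seenP xX.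
have [zb nza nzc] := privBP zB; have [ua nub nuc] := privP nab nac nbc uA.
have zx : e z x by apply: contraT => nzx; split_na; indep4 u z x c.
move: xX; rewrite seenE => /andP[/pairedP[xS mxS _] _].
by rewrite -(split_pair' nab nac nbc zB xS mxS nxm).
Qed.

(** Among the common neighbours of [z] and [a], both [x] and [y] are non-neighbours of [u]. *)
Lemma same_side_inj z x y : z \in priv e a c :\ b -> e z u ->
  x \in X -> y \in X -> e z x -> e z y -> x = y.
Proof.
move=> zB zu xX yX zx zy.
have [[xa xb nxc] _ _ _ [nux _]] := seenP xX; have [[ya yb nyc] _ _ _ [nuy _]] := seenP yX.
have [zb nza nzc] := privBP zB; have [ua nub nuc] := privP nab nac nbc uA.
by apply: (matching nza (x := u)); split_na; adj.
Qed.

Lemma same_side_mate z x : z \in priv e a c :\ b -> x \in X ->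
  e z (m x) = ~~ e z x.
Proof.
move=> zB; rewrite seenE => /andP[/pairedP[xS mxS nxm] _].
by rewrite (split_pair' nab nac nbc zB xS mxS nxm) negbK.
Qed.

(** Among the common neighbours of [u] and [b], both [y] and [z] are non-neighbours of [m x]. *)
Lemma seen_determines x y z : x \in X -> y \in priv e a c :\ b -> z \in priv e a c :\ b ->
  e y u -> e z u -> e y x -> e z x -> y = z.
Proof.
move=> xX yB zB yu zu yx zx.
have nym : ~~ e y (m x) by rewrite same_side_mate // negbK.
have nzm : ~~ e z (m x) by rewrite same_side_mate // negbK.
have [_ [xa xb nxc] _ _ [_ um]] := seenP xX.
have [yb nya nyc] := privBP yB; have [zb nza nzc] := privBP zB.
have [ua nub nuc] := privP nab nac nbc uA.
by apply: (matching nub (x := m x)); split_na; adj.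
Qed.

(** If [z] misses [x], [y] and [t], then [z] and [x] are nonadjacent with common neighbours [v],
    [m y] and [m t], and [v] misses the last two. Thus [z] and [v] differ in at most two places. *)
Lemma card_unseen z : z \in priv e a c :\ b -> e z u -> #|[set x in X | ~~ e z x]| <= 2.
Proof.
move=> zB zu; apply: card_le2 => x y t /setIdP[xX nzx] /setIdP[yX nzy] /setIdP[tX nzt] xy yt tx.
have [[xa xb nxc] [xa' xb' nxc'] nxm [vx nvx] [nux ux]] := seenP xX.
have [[ya yb nyc] [ya' yb' nyc'] nym [vy nvy] [nuy uy]] := seenP yX.
have [[ta tb ntc] [ta' tb' ntc'] ntm [vt nvt] [nut ut]] := seenP tX.
have [zb nza nzc] := privBP zB.
have zy : e z (m y) by rewrite same_side_mate.
have zt : e z (m t) by rewrite same_side_mate.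
have mx s : s \in X -> s != x -> e x (m s).
  move=> sX sx; apply: contraT => nxs.
  have [[sa sb nsc] [sa' sb' nsc'] nsm [vs nvs] _] := seenP sX.
  case/eqP: sx; apply: (matching nab (x := m s)) => //; last by nadj.
  by rewrite na_sym.
have xmy : e x (m y) by apply: mx => //; rewrite eq_sym.
have xmt : e x (m t) by apply: mx.
have vz : e v z.
  have /cliqueP cB := priv_clique alpha3 nac.
  move: (vB) (zB) => /setD1P[_ vB'] /setD1P[_ zB'].
  by apply: cB => //; neq.
have nzx' : na z x by split_na; nadj.
case/eqP: yt; apply: mate_inj_seen => //.
by apply: (matching nzx' (x := v)); split_na; adj.
Qed.

Lemma card_seen_le z : z \in priv e a c :\ b -> e z u -> #|[set x in X | e z x]| <= 1.
Proof.
move=> zB zu; apply/card_le1_eqP=> x y /setIdP[xX zx] /setIdP[yX zy].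
exact: same_side_inj zB zu yX xX zy zx.
Qed.

Lemma card_seen_split z : #|[set x in X | e z x]| + #|[set x in X | ~~ e z x]| = npairs e S.
Proof.
have -> : [set x in X | e z x] = X :&: [set x | e z x].
  by apply/setP=> x; rewrite in_setI [LHS]in_set [x \in [set _ | e z _]]in_set.
have -> : [set x in X | ~~ e z x] = X :\: [set x | e z x].
  by apply/setP=> x; rewrite in_setD andbC [LHS]in_set [x \in [set _ | e z _]]in_set.
by rewrite cardsID card_seen.
Qed.

Lemma npairs_le3 z : z \in priv e a c :\ b -> e z u -> npairs e S <= 3.
Proof.
move=> zB zu; have := card_seen_le zB zu; have := card_unseen zB zu.
by have := card_seen_split z; card_lia.
Qed.

(* Each z of B° adjacent to u agrees with v on exactly one pair, and that pair
   determines z. *)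
Lemma card_adjacent_side :
  npairs e S = 3 -> #|[set z in priv e a c :\ b | e z u]| <= 3.
Proof.
move=> p3; rewrite -[X in _ <= X]p3 -card_seen.
pose k z := odflt z [pick x in X | e z x].
have kP z : z \in priv e a c :\ b -> e z u -> k z \in X /\ e z (k z).
  move=> zB zu; rewrite /k; case: pickP => [x /andP[]//|h].
  have := card_seen_split z; rewrite p3.
  suff -> : [set x in X | e z x] = set0 by rewrite cards0; have := card_unseen zB zu; card_lia.
  by apply/setP=> x; rewrite in_set h inE.
rewrite -(@card_in_imset _ _ k).
  apply: subset_leq_card; apply/subsetP=> _ /imsetP[z /setIdP[zB zu] ->].
  by have [] := kP z zB zu.
move=> y z /setIdP[yB yu] /setIdP[zB zu] E.
have [yX yk] := kP y yB yu; have [_ zk] := kP z zB zu; rewrite -E in zk.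
exact: (@seen_determines (k y)).
Qed.

(** All of B° then has the pattern of [v], so [priv e a c] and the clique [X] together form a
    clique. *)
Lemma card_priv_opposite : (forall z, z \in priv e a c :\ b -> ~~ e z u) ->
  #|priv e a c| + npairs e S <= w.
Proof.
move=> opp; rewrite -card_seen -cardsU_disjoint; last first.
  apply/pred0P=> x; apply/negP=> /andP[xB /seenP[[xa _ _] _ _ _ _]].
  have : x \in priv e a c by [].
  by rewrite inE => /andP[/andP[_ /negP]].
apply: clique_bound; apply: cliqueU => //; first exact: priv_clique.
  apply/cliqueP=> x y xX yX ne; have [[xa xb nxc] _ _ [vx _] _] := seenP xX.
  have [[ya yb nyc] _ _ [vy _] _] := seenP yX.
  apply: contraT => nxy; have nxy' : na x y by nadj.
  have := split_pair' nab nac nbc vB (x := x) (y := y).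
  by rewrite !inE xa xb nxc ya yb nyc vx vy => /(_ isT isT nxy').
move=> z x zB xX ne; have [->|zb] := eqVneq z b.
  by have [[_ xb _] _ _ _ _] := seenP xX; edge.
have zB' : z \in priv e a c :\ b by apply/setD1P.
by have [] := opposite_side zB' (opp z zB') xX.
Qed.

(** [u] sees one end of each pair only, so these vertices form a clique, which both [u] and [a]
    extend. *)
Lemma card_duo_side : #|[set x in S | e u x]| + 2 <= w.
Proof.
have [ua nub nuc] := privP nab nac nbc uA.
have nuD : u \notin [set x in S | e u x] by apply/negP=> /setIdP[_]; rewrite eirr.
have <- : #|u |: [set x in S | e u x]| + 1 = #|[set x in S | e u x]| + 2.
  by rewrite cardsU1 nuD; card_lia.
rewrite addn1; apply: (@clique_lt _ a).
  apply: cliqueU1 => //; last by move=> y /setIdP[].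
  apply/cliqueP=> x y /setIdP[xS ux] /setIdP[yS uy] ne; apply: contraT => nxy.
  have nxy' : na x y by apply/andP.
  by have := split_pair nab nac nbc uA xS yS nxy'; rewrite ux uy.
by move=> x; rewrite in_setU1 => /orP[/eqP->|/setIdP[/duoP[]]].
Qed.

End NonadjacentPair.

(** * Far vertices when adjacency between A° and B° is mixed *)

Section BothSides.
Variables a b c u v : T.
Hypotheses (nab : na a b) (nac : na a c) (nbc : na b c).
Hypotheses (uA : u \in priv e b c :\ a) (vB : v \in priv e a c :\ b) (nuv : ~~ e u v).
Local Notation S := (duo e a b c).
Local Notation p := (npairs e S).

Let nba : na b a. Proof. by rewrite na_sym. Qed.
Let nvu : ~~ e v u. Proof. by rewrite esym. Qed.

Lemma mate_seen y : y \in seen S u ->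
  mate e S y \in seen S v /\ mate e S (mate e S y) = y.
Proof.
rewrite [S]duoC => yY; have [_ _ _ _ [_ vm]] := seenP nba nbc nac vB uA nvu yY.
move: yY; rewrite !seenE vm -duoC => /andP[yP _].
by have [-> ->] := mate_paired esym (duo_matched (c := c) nab) yP.
Qed.

(** [z] has the pattern of [v] and misses [seen S u], of which [u1] sees some [y0] and misses some
    [y1]. Then [z] sees [u1], or else [u1], [z], [y1], [c] would be independent; so [z] and [v] are
    both non-neighbours of [y0] among the common neighbours of [u1] and [b]. *)
Lemma far_side_unique u1 z : 3 <= p -> u1 \in priv e b c :\ a -> e u1 v ->
  z \in priv e a c :\ b -> ~~ e z u -> z = v.
Proof.
move=> p3 u1A u1v zB nzu.
have far y : y \in seen S u -> ~~ e z y.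
  move=> yY; have [mX mm] := mate_seen yY.
  by have [_] := opposite_side nab nac nbc uA vB nuv zB nzu mX; rewrite mm.
have := card_seen_split nba nbc nac uA u1.
have := card_seen_le nba nbc nac vB uA nvu u1A u1v.
have := card_unseen nba nbc nac vB uA nvu u1A u1v.
rewrite [duo e b a c]duoC => le2 le1 Ep.
have [y0 /setIdP[y0Y u1y0]] : exists y, y \in [set x in seen S u | e u1 x].
  by apply/card_gt0P; move: p3 le2 le1 Ep; card_lia.
have [y1 /setIdP[y1Y nu1y1]] : exists y, y \in [set x in seen S u | ~~ e u1 x].
  by apply/card_gt0P; move: p3 le2 le1 Ep; card_lia.
have [u1a nu1b nu1c] := privP nab nac nbc u1A.
have [vb nva nvc] := privBP nab nac nbc vB.
have [zb nza nzc] := privBP nab nac nbc zB.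
have := (seenP nba nbc nac vB uA nvu); rewrite [duo e b a c]duoC => sP.
have [[y0b y0a ny0c] _ _ _ [nvy0 _]] := sP _ y0Y.
have [[y1b y1a ny1c] _ _ _ [nvy1 _]] := sP _ y1Y.
have nzy0 := far y0 y0Y; have nzy1 := far y1 y1Y.
have zu1 : e z u1.
  by apply: contraT => nzu1; split_na; indep4 u1 z y1 c.
by symmetry; apply: (matching nu1b (x := y0)); split_na; adj.
Qed.

Lemma card_far_side : 3 <= p -> (exists2 u1, u1 \in priv e b c :\ a & e u1 v) ->
  #|[set z in priv e a c :\ b | ~~ e z u]| <= 1.
Proof.
move=> p3 [u1 u1A u1v]; apply/card_le1_eqP=> x y /setIdP[xB nxu] /setIdP[yB nyu].
by rewrite (far_side_unique p3 u1A u1v xB nxu) (far_side_unique p3 u1A u1v yB nyu).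
Qed.

Lemma card_priv_split : #|priv e a c| =
  (#|[set z in priv e a c :\ b | e z u]| + #|[set z in priv e a c :\ b | ~~ e z u]|).+1.
Proof.
rewrite (cardsD1 b) in_set nba nbc add1n -(cardsID [set z | e z u] (priv e a c :\ b)).
congr (_ + _).+1; apply: eq_card => z.
  by rewrite !inE.
by rewrite !inE andbC.
Qed.

End BothSides.

(** Every vertex of the duo sees [u] or [v], by independence with [c]. The cases depend on whether
    B° has a neighbour of [u] and A° a neighbour of [v]. If only one side has one, the other side is
    its base vertex and at most one far vertex; if both do, each side has at most 1 + 3 + 1
    vertices. *)
Lemma card_priv_cases a b c u v : na a b -> na a c -> na b c ->
  u \in priv e b c :\ a -> v \in priv e a c :\ b -> ~~ e u v ->
  let p := npairs e (duo e a b c) in 3 <= p ->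
  #|duo e a b c| + 4 <= 2 * w /\
  [\/ #|priv e b c| + p <= w /\ #|priv e a c| + p <= w,
      p = 3 /\ (#|priv e b c| <= 2 \/ #|priv e a c| <= 2)
    | [/\ p = 3, #|priv e b c| <= 5 & #|priv e a c| <= 5] ].
Proof.
move=> nab nac nbc uA vB nuv p p3.
have nba : na b a by rewrite na_sym.
have nvu : ~~ e v u by rewrite esym.
have p3' : 3 <= npairs e (duo e b a c) by rewrite duoC.
have pE : npairs e (duo e b a c) = p by rewrite duoC.
split.
  have := card_duo_side nab nac nbc uA; have := card_duo_side nba nbc nac vB.
  rewrite [duo e b a c]duoC.
  have sub : duo e a b c \subset
      [set x in duo e a b c | e u x] :|: [set x in duo e a b c | e v x].
    apply/subsetP=> x xS; have [xa xb nxc] := duoP xS; apply/setUP.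
    have [ua nub nuc] := privP nab nac nbc uA; have [vb nva nvc] := privBP nab nac nbc vB.
    case: (boolP (e u x)) => [ux|nux]; first by left; apply/setIdP.
    right; apply/setIdP; split=> //; apply: contraT => nvx.
    by split_na; indep4 u v x c.
  have := subset_leq_card sub.
  have := (leq_card_setU [set x in duo e a b c | e u x] [set x in duo e a b c | e v x]).1.
  by card_lia.
have EB := card_priv_split u nab nbc; have EA := card_priv_split v nba nac.
have fB := card_far_side nab nac nbc uA vB nuv p3.
have fA : (exists2 v1, v1 \in priv e a c :\ b & e v1 u) -> _ :=
  card_far_side nba nbc nac vB uA nvu p3'.
have nA := card_adjacent_side nba nbc nac vB uA nvu.
have nB := card_adjacent_side nab nac nbc uA vB nuv.
have oB := card_priv_opposite nab nac nbc uA vB nuv.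
have oA := card_priv_opposite nba nbc nac vB uA nvu.
rewrite pE in nA oA; rewrite EA EB.
have noP x y z t : #|[set s in priv e x y :\ z | e s t]| = 0 ->
    forall s, s \in priv e x y :\ z -> ~~ e s t.
  move=> /eqP; rewrite cards_eq0 => /eqP E s sP; apply/negP=> st.
  by have := in_set0 s; rewrite -E => /setIdP; case.
have [E0|/card_gt0P[z /setIdP[zB zu]]] := posnP #|[set z in priv e a c :\ b | e z u]|;
  have [E0'|/card_gt0P[z' /setIdP[zA zv]]] := posnP #|[set z in priv e b c :\ a | e z v]|.
- constructor 1; rewrite -EA -EB; split; [apply: oA|apply: oB]; exact: noP.
- constructor 2; have Ep : p = 3.
    by apply/eqP; rewrite eqn_leq p3 andbT -pE (npairs_le3 nba nbc nac vB uA nvu zA zv).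
  split=> //; right; have := fB (ex_intro2 _ _ z' zA zv); move: E0; card_lia.
- constructor 2; have Ep : p = 3.
    by apply/eqP; rewrite eqn_leq p3 andbT (npairs_le3 nab nac nbc uA vB nuv zB zu).
  split=> //; left; have := fA (ex_intro2 _ _ z zB zu); move: E0'; card_lia.
- constructor 3; have Ep : p = 3.
    by apply/eqP; rewrite eqn_leq p3 andbT (npairs_le3 nab nac nbc uA vB nuv zB zu).
  have := fB (ex_intro2 _ _ z' zA zv); have := fA (ex_intro2 _ _ z zB zu).
  have := nA Ep; have := nB Ep; move=> h1 h2 h3 h4; split=> //.
    by move: h2 h3; card_lia.
  by move: h1 h4; card_lia.
Qed.


(** ** The bound on the number of vertices *)

Definition complete_sides a b c :=
  [forall u in priv e b c :\ a, forall v in priv e a c :\ b, e u v].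

Lemma complete_sidesP a b c : reflect
  {in priv e b c :\ a & priv e a c :\ b, forall u v, e u v} (complete_sides a b c).
Proof.
apply: (iffP forallP) => [h u v uA vB|h u].
  by have /implyP/(_ uA)/forallP/(_ v)/implyP := h u; apply.
apply/implyP=> uA; apply/forallP=> v; apply/implyP=> vB; exact: h.
Qed.

Lemma incomplete_sides a b c : ~~ complete_sides a b c ->
  exists u v, [/\ u \in priv e b c :\ a, v \in priv e a c :\ b & ~~ e u v].
Proof.
move=> /forallPn[u]; rewrite negb_imply => /andP[uA /forallPn[v]].
by rewrite negb_imply => /andP[vB nuv]; exists u, v.
Qed.

Lemma priv1_clique a b c : na b c -> is_clique e (priv e b c :\ a).
Proof. by move=> nbc; apply: cliqueS (priv_clique alpha3 nbc); apply: subsetDl. Qed.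

Lemma card_priv1 a b c : na a b -> na a c -> #|priv e b c| = #|priv e b c :\ a|.+1.
Proof. by move=> nab nac; rewrite (cardsD1 a) in_set nab nac. Qed.

Lemma priv_disjoint a b c : na a b -> na a c -> na b c ->
  [disjoint priv e b c & priv e a c].
Proof.
move=> nab nac nbc; apply/pred0P=> x; apply/negP=> /andP[/= xA xB].
have : x \in priv e b c by [].
rewrite inE => /andP[xb xc]; have : x \in priv e a c by [].
rewrite inE => /andP[xa _].
exact: (@alpha3 x a b c).
Qed.

Lemma priv1_disjoint a b c : na a b -> na a c -> na b c ->
  [disjoint priv e b c :\ a & priv e a c :\ b].
Proof.
move=> nab nac nbc; apply: disjointWl (subsetDl _ _) _.
by apply: disjointWr (subsetDl _ _) _; apply: priv_disjoint.
Qed.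

Lemma complete_clique2 a b c : na a b -> na a c -> na b c -> complete_sides a b c ->
  is_clique e (priv e b c :\ a :|: priv e a c :\ b).
Proof.
move=> nab nac nbc /complete_sidesP cmp.
by apply: cliqueU => //; [exact: priv1_clique|exact: priv1_clique|move=> ? ? ? ? _; apply: cmp].
Qed.

Lemma card_complete2 a b c : na a b -> na a c -> na b c -> complete_sides a b c ->
  #|priv e b c :\ a| + #|priv e a c :\ b| <= w.
Proof.
move=> nab nac nbc cmp; rewrite -cardsU_disjoint; last exact: priv1_disjoint.
exact/clique_bound/complete_clique2.
Qed.

Lemma complete_clique3 a b c : na a b -> na a c -> na b c ->
  complete_sides a b c -> complete_sides a c b -> complete_sides b c a ->
  is_clique e (priv e b c :\ a :|: priv e a c :\ b :|: priv e a b :\ c).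
Proof.
move=> nab nac nbc cab /complete_sidesP cac /complete_sidesP cbc.
apply: cliqueU => //; [exact: complete_clique2|exact: priv1_clique|].
move=> x y; rewrite in_setU => /orP[xA|xB] yC _.
  by apply: cac; rewrite // [priv e c b]privC.
by apply: cbc; rewrite // ?[priv e c a]privC // [priv e b a]privC.
Qed.

Lemma card_complete3 a b c : na a b -> na a c -> na b c ->
  complete_sides a b c -> complete_sides a c b -> complete_sides b c a ->
  #|priv e b c :\ a| + #|priv e a c :\ b| + #|priv e a b :\ c| <= w.
Proof.
move=> nab nac nbc cab cac cbc.
rewrite -cardsU_disjoint; last exact: priv1_disjoint.
rewrite -cardsU_disjoint; first exact/clique_bound/complete_clique3.
have nca : na c a by rewrite na_sym.
have ncb : na c b by rewrite na_sym.
have nba : na b a by rewrite na_sym.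
rewrite -setI_eq0 setIUl setU_eq0 !setI_eq0 [priv e b c]privC priv1_disjoint //.
by rewrite [priv e a c]privC [priv e a b]privC priv1_disjoint.
Qed.

Lemma card_le_triple a b c : na a b -> na a c -> na b c ->
  #|T| <= #|priv e b c| + #|priv e a c| + #|priv e a b| + #|duo e a b c|
          + #|duo e a c b| + #|duo e b c a| + #|trio e a b c|.
Proof.
move=> nab nac nbc.
pose U1 := priv e b c :|: priv e a c; pose U2 := U1 :|: priv e a b.
pose U3 := U2 :|: duo e a b c; pose U4 := U3 :|: duo e a c b; pose U5 := U4 :|: duo e b c a.
have sub : [set: T] \subset U5 :|: trio e a b c.
  apply/subsetP=> x _; have := triple_cover esym alpha3 x nab nac nbc.
  by rewrite !in_setU; do 6!case: (x \in _) => //=.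
have := subset_leq_card sub; rewrite cardsT.
have := (leq_card_setU U5 (trio e a b c)).1; have := (leq_card_setU U4 (duo e b c a)).1.
have := (leq_card_setU U3 (duo e a c b)).1; have := (leq_card_setU U2 (duo e a b c)).1.
have := (leq_card_setU U1 (priv e a b)).1; have := (leq_card_setU (priv e b c) (priv e a c)).1.
rewrite -/U1 -/U2 -/U3 -/U4 -/U5; card_lia.
Qed.

Lemma card_sides a b c : na a b -> na a c -> na b c ->
  let p := npairs e (duo e a b c) in 3 <= p ->
  [\/ complete_sides a b c /\ #|priv e b c| + #|priv e a c| <= w + 2,
      #|priv e b c| + p <= w /\ #|priv e a c| + p <= w,
      p = 3 /\ (#|priv e b c| <= 2 \/ #|priv e a c| <= 2)
    | [/\ p = 3, #|priv e b c| <= 5, #|priv e a c| <= 5 & #|duo e a b c| + 4 <= 2 * w] ].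
Proof.
move=> nab nac nbc p p3; have nba : na b a by rewrite na_sym.
have [cmp|/incomplete_sides[u [v [uA vB nuv]]]] := boolP (complete_sides a b c).
  constructor 1; split=> //; have := card_complete2 nab nac nbc cmp.
  rewrite (card_priv1 nab nac) (card_priv1 nba nbc); card_lia.
have [le2 []] := card_priv_cases nab nac nbc uA vB nuv p3.
- by constructor 2.
- by constructor 3.
- by case=> *; constructor 4.
Qed.

(* The trio, with one side of every pair of duo a b c, is a clique in the
   neighbourhood of a; this pays for the largest of the three numbers of pairs. *)
Lemma card_bound_sorted a b c : na a b -> na a c -> na b c ->
  npairs e (duo e a c b) <= npairs e (duo e b c a) <= npairs e (duo e a b c) ->
  #|T| <= 7 * w.
Proof.
move=> nab nac nbc.
have nba : na b a by rewrite na_sym.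
have nca : na c a by rewrite na_sym.
have ncb : na c b by rewrite na_sym.
have hn := card_le_triple nab nac nbc.
have hA := clique_bound (priv_clique alpha3 nbc).
have hB := clique_bound (priv_clique alpha3 nac).
have hC := clique_bound (priv_clique alpha3 nab).
have dab := card_duo c nab; have dac := card_duo b nac; have dbc := card_duo a nbc.
have tab := top_duo_lt a b c; have tac := top_duo_lt a c b; have tbc := top_duo_lt b c a.
have ht := card_trio nab nac nbc.
have sab := card_sides nab nac nbc.
have sac := card_sides nac nab ncb; have sbc := card_sides nbc nba nca.
have all3 := card_complete3 nab nac nbc.
have eA := card_priv1 nab nac; have eB := card_priv1 nba nbc; have eC := card_priv1 nca ncb.
move: hn hA hB hC dab dac dbc tab tac tbc ht sab sac sbc all3 eA eB eC.
rewrite [priv e c b]privC [priv e c a]privC [priv e b a]privC /=.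
repeat match goal with |- context [card ?A] =>
  let n := fresh "n" in generalize (card A) => n end.
generalize (npairs e (duo e a b c)) (npairs e (duo e b c a)) (npairs e (duo e a c b)).
generalize (complete_sides a b c : Prop) (complete_sides a c b : Prop)
  (complete_sides b c a : Prop) w.
move=> cab cac cbc W p q r hn hA hB hC dab dac dbc tab tac tbc ht sab sac sbc all3 eA eB eC.
move=> /andP[rq qp].
clear -hn hA hB hC dab dac dbc tab tac tbc ht sab sac sbc all3 eA eB eC rq qp.
(* Each duo has at most [W - 1] vertices plus its number of pairs, and the trio at most [W - 1 - p].
   So [p] cancels and the total is at most [7W - 4 + q + r]. *)
have [small|big] := leqP (q + r) 4; first by lia.
have [|[hab hab']|[hab hab']|[hab [hab'|hab']]|[hab hab' hab'' hab3]] := sab; try lia.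
(* Here A and B save [W - 2], so the total is at most [6W - 2 + q + r], and [q < W] settles
   [r <= 3]. For [r >= 4] only the case of three complete sides survives the arithmetic. *)
- have [r3|r4] := leqP r 3; first by lia.
  have [|[hbc hbc']|[hbc hbc']|[hbc [hbc'|hbc']]|[hbc hbc' hbc'' hbc3]] := sbc; try lia.
  have [|[hac hac']|[hac hac']|[hac [hac'|hac']]|[hac hac' hac'' hac3]] := sac; try lia.
  by have := all3 hab hac hbc; lia.
(* Here [p = 3] and A and B have at most 5 vertices each. The bounds so far leave open only [W = 5],
   [q = r = 3], where they sum to 36. *)
- have [r2|r3] := leqP r 2; first by lia.
  by have [|[hac hac']|[hac hac']|[hac [hac'|hac']]|[hac hac' hac'' hac3]] := sac; lia.
Qed.


Lemma card_bound a b c : na a b -> na a c -> na b c -> #|T| <= 7 * w.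
Proof.
move=> nab nac nbc.
have nba : na b a by rewrite na_sym.
have nca : na c a by rewrite na_sym.
have ncb : na c b by rewrite na_sym.
have srt := card_bound_sorted.
have dba := duoC e b a c; have dca := duoC e c a b; have dcb := duoC e c b a.
(* Two of the eight comparison patterns are cyclic, hence impossible. *)
have [h1|h1] := leqP (npairs e (duo e a b c)) (npairs e (duo e a c b));
  have [h2|h2] := leqP (npairs e (duo e a b c)) (npairs e (duo e b c a));
  have [h3|h3] := leqP (npairs e (duo e a c b)) (npairs e (duo e b c a)).
- by apply: (srt b c a); rewrite // ?dba ?dca ?dcb h1 h3.
- by apply: (srt a c b); rewrite // ?dba ?dca ?dcb h2 ltnW.
- by have := leq_ltn_trans (leq_trans h1 h3) h2; rewrite ltnn.
- by apply: (srt c a b); rewrite // ?dba ?dca ?dcb h1 ltnW.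
- by apply: (srt c b a); rewrite // ?dba ?dca ?dcb h2 ltnW.
- by have := ltn_trans h1 (leq_ltn_trans h2 h3); rewrite ltnn.
- by apply: (srt a b c); rewrite // h3 ltnW.
- by apply: (srt b a c); rewrite // ?dba ?dca ?dcb (ltnW h3) (ltnW h1).
Qed.

(** ** The bound on the chromatic number *)

Lemma matching_coP3uP2_free a b x y z : na a b ->
  e x a -> e x b -> e y a -> e y b -> e z a -> e z b -> e y z -> na x y -> e x z.
Proof.
move=> nab xa xb ya yb za zb yz nxy; apply: contraT => nxz.
have ne : x != z by apply: contraTneq yz => <-; rewrite esym; case/andP: nxy.
have E : y = z by apply: (matching nab (x := x)) => //; apply/andP.
by rewrite E eirr in yz.
Qed.

Let colorable_on_common' := colorable_on_common esym eirr matching_coP3uP2_free.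

(** A with B, and C with a largest clique of the duo, are cobipartite and cost [w] colours each. The
    rest of the duo costs one colour per pair, and two common neighbourhoods, at [w - 1] each, cover
    all else. *)
Lemma colorable_on_few_pairs a b c : na a b -> na a c -> na b c ->
  colorable_on e [set: T] (4 * w - 2 + npairs e (duo e a b c)).
Proof.
move=> nab nac nbc.
have mS := duo_matched (c := c) nab.
have [sQ cQ _] := topP e (duo e a b c).
have h1 : colorable_on e (priv e b c :|: priv e a c) w.
  apply: colorable_on_cobipartite => //; try exact: priv_clique.
    exact: priv_disjoint.
  by move=> Q _; apply: clique_bound.
have h2 : colorable_on e (priv e a b :|: top e (duo e a b c)) w.
  apply: colorable_on_cobipartite => //; first exact: priv_clique.
    apply/pred0P=> x; apply/negP=> /andP[/= xC /(subsetP sQ)/duoP[xa _ _]].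
    have : x \in priv e a b by [].
    by rewrite inE => /andP[/andP[_ /negP]].
  by move=> Q _; apply: clique_bound.
have h3 := colorable_on_card eirr (duo e a b c :\: top e (duo e a b c)).
rewrite card_rest // in h3.
have := colorable_onU (colorable_onU h1 h2)
  (colorable_onU h3 (colorable_onU (colorable_on_common' nac) (colorable_on_common' nbc))).
move/colorable_onW; apply.
  apply/subsetP=> x _; have := triple_cover esym alpha3 x nab nac nbc.
  rewrite !in_setU in_setD; case: (x \in priv e b c); rewrite ?orbT //.
  case: (x \in priv e a c); rewrite ?orbT //; case: (x \in priv e a b); rewrite ?orbT //=.
  case: (x \in top e _); rewrite ?orbT //; case: (x \in duo e a b c); rewrite ?orbT //=.
  by case/or3P; rewrite !inE => /and3P[xa xb xc]; rewrite xa xb ?orbT // xc orbT.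
have : 0 < w by have := top_duo_lt a b c; card_lia.
by lia.
Qed.

(** Among the common neighbours of [y] and [a], both [x1] and [x2] are non-neighbours of [t]. So the
    patterns of [t] and [y] differ in at most one place. *)
Lemma cross_le1 a b c y t x1 x2 : na a b -> na a c -> na b c ->
  t \in priv e b c :\ a -> y \in priv e a c :\ b -> e y t ->
  x1 \in duo e a b c -> x2 \in duo e a b c -> e y x1 -> e y x2 ->
  ~~ e t x1 -> ~~ e t x2 -> x1 = x2.
Proof.
move=> nab nac nbc tA yB yt /duoP[x1a x1b nx1c] /duoP[x2a x2b nx2c] yx1 yx2 nt1 nt2.
have [ta ntb ntc] := privP nab nac nbc tA.
have [yb nya nyc] := privBP nab nac nbc yB.
by apply: (matching nya (x := t)); split_na; adj.
Qed.

Lemma seen_duo S v x : x \in seen S v -> x \in S.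
Proof. by rewrite seenE => /andP[/(pairedP (e := e))[]]. Qed.

(** * Patterns of length three *)

Section ThreePairs.
Variables a b c u v : T.
Hypotheses (nab : na a b) (nac : na a c) (nbc : na b c).
Hypotheses (uA : u \in priv e b c :\ a) (vB : v \in priv e a c :\ b) (nuv : ~~ e u v).
Local Notation S := (duo e a b c).
Local Notation X := (seen S v).
Local Notation m := (mate e S).
Hypothesis p3 : npairs e S = 3.

Let nba : na b a. Proof. by rewrite na_sym. Qed.
Let nvu : ~~ e v u. Proof. by rewrite esym. Qed.
Let dC : duo e b a c = S. Proof. by rewrite duoC. Qed.

Lemma mate_seen' x : x \in X -> m x \in seen S u /\ m (m x) = x.
Proof. by move=> xX; have := mate_seen nba nbc nac vB uA nvu; rewrite dC; apply. Qed.

(** [y] agrees with [v], and [t] with [u], only at the pair of [x]. So [y] and [t] differ at the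
    other two pairs as well, against [cross_le1]. *)
Lemma cross_adjacent_some t y x : t \in priv e b c :\ a -> y \in priv e a c :\ b ->
  e y t -> e y u -> e t v -> x \in X -> e y x -> e t (m x) -> False.
Proof.
move=> tA yB yt yu tv xX yx tmx.
have : 1 < #|X :\ x|.
  have := cardsD1 x X; rewrite xX (card_seen nab nac nbc vB) p3; card_lia.
case/card_gt1P=> x1 [x2 [/setD1P[x1x x1X] /setD1P[x2x x2X] ne]].
have key z : z != x -> z \in X -> e y (m z) /\ ~~ e t (m z).
  move=> zx zX; rewrite (same_side_mate nab nac nbc yB zX).
  have [mzX mmz] := mate_seen' zX; have [mxX mmx] := mate_seen' xX.
  split; apply/negP=> h; case/eqP: zx.
    exact: (same_side_inj nab nac nbc uA vB nuv yB yu).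
  have := same_side_inj nba nbc nac vB uA nvu tA tv; rewrite dC => inj.
  by rewrite -mmz -mmx (inj _ _ mzX mxX h tmx).
have [ym1 nt1] := key x1 x1x x1X; have [ym2 nt2] := key x2 x2x x2X.
have [m1X _] := mate_seen' x1X; have [m2X _] := mate_seen' x2X.
case/eqP: ne; apply: (mate_inj_seen nab x1X x2X).
exact: (cross_le1 nab nac nbc tA yB yt (seen_duo m1X) (seen_duo m2X)).
Qed.

(** [y] has the pattern of [v] and [t] that of [u]; these are opposite, against [cross_le1]. *)
Lemma cross_adjacent_none t y : t \in priv e b c :\ a -> y \in priv e a c :\ b ->
  e y t -> ~~ e y u -> ~~ e t v -> False.
Proof.
move=> tA yB yt nyu ntv.
have : 1 < #|X| by rewrite (card_seen nab nac nbc vB) p3.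
case/card_gt1P=> x1 [x2 [x1X x2X ne]].
have key z : z \in X -> e y z /\ ~~ e t z.
  move=> zX; have [mzX mmz] := mate_seen' zX.
  have [yz _] := opposite_side nab nac nbc uA vB nuv yB nyu zX.
  have := opposite_side nba nbc nac vB uA nvu tA ntv; rewrite dC => /(_ _ mzX)[_].
  by rewrite mmz.
have [y1 nt1] := key x1 x1X; have [y2 nt2] := key x2 x2X; case/eqP: ne.
exact: (cross_le1 nab nac nbc tA yB yt (seen_duo x1X) (seen_duo x2X)).
Qed.

Lemma exists_seen z : z \in priv e a c :\ b -> e z u -> exists2 x, x \in X & e z x.
Proof.
move=> zB zu; have [x] : exists x, x \in [set x in X | e z x].
  apply/card_gt0P; have := card_seen_split nab nac nbc vB z.
  have := card_unseen nab nac nbc uA vB nuv zB zu; rewrite p3; card_lia.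
by case/setIdP; exists x.
Qed.

End ThreePairs.

(* The vertices u and v share a colour, and the other vertices of A° and B°
   are coloured by the pair on which they agree with v, resp. differ from u. *)
Lemma colorable_on_mixed_sides a b c u v : na a b -> na a c -> na b c ->
  u \in priv e b c :\ a -> v \in priv e a c :\ b -> ~~ e u v ->
  npairs e (duo e a b c) = 3 ->
  (exists2 z, z \in priv e b c :\ a & e z v) -> (exists2 z, z \in priv e a c :\ b & e z u) ->
  colorable_on e (priv e b c :\ a :|: priv e a c :\ b) 4.
Proof.
move=> nab nac nbc uA vB nuv p3 exA exB.
have nba : na b a by rewrite na_sym.
have nvu : ~~ e v u by rewrite esym.
have dC : duo e b a c = duo e a b c by rewrite duoC.
have p3' : npairs e (duo e b a c) = 3 by rewrite dC.
pose m := mate e (duo e a b c); pose X := seen (duo e a b c) v.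
(* [Some x] names the pair at which [z] agrees with [v] if [z] is in B°, with [u] if it is in A°.
   The colour [None] is left for far vertices, which are only [v] and [u]. *)
pose F z := if z \in priv e a c :\ b
  then if e z u then [pick x in X | e z x] else None
  else if e z v then [pick x in X | e z (m x)] else None.
have FB z : z \in priv e a c :\ b ->
    if F z is Some x then [/\ e z u, x \in X & e z x] else ~~ e z u.
  rewrite /F => zB; rewrite zB; case: (boolP (e z u)) => // zu.
  case: pickP => [x /andP[]//|h].
  by have [x xX zx] := exists_seen nab nac nbc uA vB nuv p3 zB zu; have := h x; rewrite xX zx.
have FA z : z \in priv e b c :\ a ->
    if F z is Some x then [/\ e z v, x \in X & e z (m x)] else ~~ e z v.
  rewrite /F => zA; have zB : z \notin priv e a c :\ b.
    by rewrite (disjointFr (priv1_disjoint nab nac nbc) zA).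
  rewrite (negPf zB); case: (boolP (e z v)) => // zv.
  case: pickP => [x /andP[]//|h].
  have [y yX zy] := exists_seen nba nbc nac vB uA nvu p3' zA zv.
  rewrite dC in yX; have [mX mm] := mate_seen nab nac nbc uA vB nuv yX.
  by have := h (mate e (duo e a b c) y); rewrite mX /m mm zy.
have cross t y : t \in priv e b c :\ a -> y \in priv e a c :\ b -> e y t -> F y != F t.
  move=> tA yB yt; have := FA t tA; have := FB y yB.
  case: (F y) => [x|]; case: (F t) => [x'|] //.
    move=> [yu xX yx] [tv _ tm]; apply/eqP=> -[E]; rewrite -E in tm.
    exact: cross_adjacent_some nab nac nbc uA vB nuv p3 t y x tA yB yt yu tv xX yx tm.
  by move=> nyu ntv; case: (cross_adjacent_none nab nac nbc uA vB nuv p3 tA yB yt nyu ntv).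
have three : 3 <= npairs e (duo e a b c) by rewrite p3.
have three' : 3 <= npairs e (duo e b a c) by rewrite p3'.
have [z0 z0A z0v] := exA; have [z1 z1B z1u] := exB.
pose Z := None |: Some @: X.
have <- : #|Z| = 4.
  rewrite /Z cardsU1 card_imset; last by move=> ? ? [].
  rewrite (card_seen nab nac nbc vB) p3; case: imsetP => [[? _]//|_]; by [].
apply: (colorable_on_img (f := F)) => [x /setUP[xA|xB]|x y].
- have := FA x xA; case: (F x) => [y [_ yX _]|_]; last by rewrite /Z setU11.
  by rewrite /Z in_setU1 imset_f.
- have := FB x xB; case: (F x) => [y [_ yX _]|_]; last by rewrite /Z setU11.
  by rewrite /Z in_setU1 imset_f.
case/setUP=> [xA|xB] /setUP[yA|yB] exy.
- have := FA y yA; have := FA x xA; case: (F x) => [t|]; case: (F y) => [s|] //.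
    move=> [xv tX xm] [yv _ ym]; apply: contraTneq exy => -[E]; rewrite -E in ym.
    have [mX _] := mate_seen' nab nac nbc uA vB nuv tX.
    have := seen_determines nba nbc nac vB uA nvu; rewrite dC => det.
    by rewrite (det _ x y mX) // eirr.
  move=> nxv nyv; apply: contraTneq exy => _.
  have far := far_side_unique nba nbc nac vB uA nvu three' z1B z1u.
  by rewrite (far x) // (far y) // eirr.
- by rewrite eq_sym; apply: cross; rewrite // esym.
- exact: cross.
have := FB y yB; have := FB x xB; case: (F x) => [t|]; case: (F y) => [s|] //.
  move=> [xu tX xt] [yu _ ys]; apply: contraTneq exy => -[E]; rewrite -E in ys.
  by rewrite (seen_determines nab nac nbc uA vB nuv tX xB yB) // eirr.
move=> nxu nyu; apply: contraTneq exy => _.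
have far := far_side_unique nab nac nbc uA vB nuv three z0A z0v.
by rewrite (far x) // (far y) // eirr.
Qed.

Lemma colorable_on_triple a b c : na a b -> na a c -> na b c ->
  colorable_on e [set a; b; c] 1.
Proof.
move=> nab nac nbc; have nba : na b a by rewrite na_sym.
have nca : na c a by rewrite na_sym.
have ncb : na c b by rewrite na_sym.
apply: colorable_on_indep => x y.
by rewrite !inE => /orP[/orP[]|] /eqP-> /orP[/orP[]|] /eqP->; rewrite ?eirr //;
  match goal with |- is_true (~~ e ?x ?y) =>
    match goal with H : is_true (compl_graph e x y) |- _ => by case/andP: (H) end end.
Qed.

Lemma triple_cover1 a b c : na a b -> na a c -> na b c ->
  [set: T] \subset [set a; b; c] :|:
      (priv e b c :\ a :|: priv e a c :\ b :|: priv e a b :\ c) :|: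
    (duo e a b c :|: (common e a c :|: common e b c)).
Proof.
move=> nab nac nbc.
apply/subsetP=> x _; have := triple_cover esym alpha3 x nab nac nbc.
rewrite !in_setU !in_setD1 !in_set1.
have [->//|_] := eqVneq x a; have [->|_] := eqVneq x b; rewrite ?orbT //.
have [->|_] := eqVneq x c; rewrite ?orbT //=.
case: (x \in priv e b c); rewrite ?orbT //.
case: (x \in priv e a c); rewrite ?orbT //; case: (x \in priv e a b); rewrite ?orbT //=.
case: (x \in duo e a b c); rewrite ?orbT //=.
by case/or3P; rewrite !inE => /and3P[xa xb xc]; rewrite xa xb ?orbT // xc orbT.
Qed.

(** * At least three pairs for every independent triple *)

Section ManyPairs.
Hypothesis many_pairs : forall a b c, na a b -> na a c -> na b c ->
  3 <= npairs e (duo e a b c).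

(** The triple [u], [b], [c] is independent too, and each of its pairs has exactly one end in B°,
    the one missing [a]: two ends missing [a] would lie in the clique [priv e a c], and two ends
    seeing [a] would be a pair of [duo e a b c] with both ends seen by [u]. *)
Lemma card_neighbours_side a b c u : na a b -> na a c -> na b c ->
  u \in priv e b c :\ a -> 3 <= #|[set z in priv e a c :\ b | e z u]|.
Proof.
move=> nab nac nbc uA; have [ua nub nuc] := privP nab nac nbc uA.
have mS := duo_matched (c := c) nub.
apply: leq_trans (many_pairs nub nuc nbc) _.
rewrite -(card_half esym mS (X := [set z in paired e (duo e u b c) | ~~ e z a])).
- apply: subset_leq_card; apply/subsetP=> z /setIdP[/pairedP[zS _ _] nza].
  have [zu zb nzc] := duoP zS; apply/setIdP; split=> //; rewrite !inE.
  have zb' : z != b by apply: contraTneq zb => ->; rewrite eirr.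
  have nba : ~~ e a b by case/andP: nab.
  have nca : ~~ e c b by rewrite esym; case/andP: nbc.
  by rewrite zb' /=; apply/andP; split; nadj.
- by apply/subsetP=> z /setIdP[].
move=> x xP; have [xS yS nxy] := pairedP xP; have [yP _] := mate_paired esym mS xP.
have [xu xb nxc] := duoP xS; have [yu yb nyc] := duoP yS.
have inX z : z \in paired e (duo e u b c) ->
    (z \in [set z in paired e (duo e u b c) | ~~ e z a]) = ~~ e z a.
  by move=> zP; apply/setIdP/idP => [[]|].
rewrite !inX //; apply/idP/idP => [nya|xa].
  apply: contraT; rewrite negbK => nxa.
  have /cliqueP cB := priv_clique alpha3 nac.
  have nba : ~~ e a b by case/andP: nab.
  have nca : ~~ e c b by rewrite esym; case/andP: nbc.
  case/andP: nxy => ne /negP[]; apply: cB => //; rewrite inE; apply/andP; split; nadj.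
rewrite negbK in xa; apply/negP=> ya.
have := split_pair nab nac nbc uA (x := x) (y := mate e (duo e u b c) x).
have ux : e u x by edge.
have uy : e u (mate e (duo e u b c) x) by edge.
by rewrite !inE xa xb nxc ya yb nyc ux uy => /(_ isT isT nxy).
Qed.

(** The lower bound 3 on the neighbours of [u] in B° meets the upper bound of [card_adjacent_side];
    the fourth vertex is [v]. *)
Lemma card_mixed_side a b c u v : na a b -> na a c -> na b c ->
  u \in priv e b c :\ a -> v \in priv e a c :\ b -> ~~ e u v ->
  npairs e (duo e a b c) = 3 /\ #|priv e a c :\ b| = 4.
Proof.
move=> nab nac nbc uA vB nuv.
have nba : na b a by rewrite na_sym.
have p3 := many_pairs nab nac nbc.
have nB := card_neighbours_side nab nac nbc uA.
have nA := card_neighbours_side nba nbc nac vB.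
have [z zB] : exists z, z \in [set z in priv e a c :\ b | e z u].
  by apply/card_gt0P; move: nB; card_lia.
have [t /setIdP[tA tv]] : exists t, t \in [set z in priv e b c :\ a | e z v].
  by apply/card_gt0P; move: nA; card_lia.
have E : npairs e (duo e a b c) = 3.
  apply/eqP; rewrite eqn_leq p3 andbT.
  by case/setIdP: zB => zB zu; apply: (npairs_le3 nab nac nbc uA vB nuv zB zu).
split=> //; have := card_priv_split u nab nbc; rewrite (card_priv1 nba nbc).
have := card_adjacent_side nab nac nbc uA vB nuv E.
have := card_far_side nab nac nbc uA vB nuv p3 (ex_intro2 _ _ t tA tv).
have : 0 < #|[set z in priv e a c :\ b | ~~ e z u]|.
  by apply/card_gt0P; exists v; apply/setIdP; rewrite esym.
move: nB; card_lia.
Qed.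

Lemma colorable_on_mixed a b c u v : na a b -> na a c -> na b c ->
  u \in priv e b c :\ a -> v \in priv e a c :\ b -> ~~ e u v ->
  colorable_on e [set: T] (4 * w).
Proof.
move=> nab nac nbc uA vB nuv.
have nba : na b a by rewrite na_sym.
have nca : na c a by rewrite na_sym.
have ncb : na c b by rewrite na_sym.
have nvu : ~~ e v u by rewrite esym.
have [E cB] := card_mixed_side nab nac nbc uA vB nuv.
have [_ cA] := card_mixed_side nba nbc nac vB uA nvu.
have p3 := many_pairs nab nac nbc.
have [le2 _] := card_priv_cases nab nac nbc uA vB nuv p3.
have hAB : colorable_on e (priv e b c :\ a :|: priv e a c :\ b) 4.
  have nB := card_neighbours_side nab nac nbc uA.
  have nA := card_neighbours_side nba nbc nac vB.
  apply: colorable_on_mixed_sides nuv E _ _ => //.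
    have [z /setIdP[zA zv]] : exists z, z \in [set z in priv e b c :\ a | e z v].
      by apply/card_gt0P; move: nA; card_lia.
    by exists z.
  have [z /setIdP[zB zu]] : exists z, z \in [set z in priv e a c :\ b | e z u].
    by apply/card_gt0P; move: nB; card_lia.
  by exists z.
have mS := duo_matched (c := c) nab.
have hD : colorable_on e (duo e a b c) #|top e (duo e a b c)|.
  by apply: colorable_on_multipartite => //; apply: matched_natr.
have hC := colorable_on_card eirr (priv e a b :\ c).
have habc := colorable_on_triple nab nac nbc.
have := colorable_onU (colorable_onU habc (colorable_onU hAB hC))
  (colorable_onU hD (colorable_onU (colorable_on_common' nac) (colorable_on_common' nbc))).
move/colorable_onW; apply; first exact: triple_cover1.
have := top_duo_lt a b c; have := card_duo c nab; rewrite E.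
have hCw := clique_bound (priv1_clique c nab).
(* The palettes add up to [2w + 3] colours plus [#|C°|] plus the largest clique of the duo. That
   clique has fewer than [w] vertices, which suits [#|C°| <= w - 4], and at most [2w - 7] by [le2],
   which suits [#|C°| = 4]. *)
have bound : #|priv e a b :\ c| + 4 <= w \/ #|priv e a b :\ c| = 4.
  have [cmp|/incomplete_sides[u' [v' [u'A v'C nuv']]]] := boolP (complete_sides a c b).
    left; have := card_complete2 nac nab ncb cmp; rewrite [priv e c b]privC cA addnC.
    by [].
  by right; have [] := card_mixed_side nac nab ncb u'A v'C nuv'.
move: le2 bound; card_lia.
Qed.

(** If all sides are complete, A°, B° and C° form one clique: [w] colours for it, one for the
    triple, and [w - 1] for each of three common neighbourhoods. *)
Lemma colorable_on_many_pairs a b c : na a b -> na a c -> na b c ->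
  colorable_on e [set: T] (4 * w).
Proof.
move=> nab nac nbc.
have nba : na b a by rewrite na_sym.
have nca : na c a by rewrite na_sym.
have ncb : na c b by rewrite na_sym.
have [cab|/incomplete_sides[u [v [uA vB nuv]]]] := boolP (complete_sides a b c); last first.
  exact: (colorable_on_mixed nab nac nbc uA vB nuv).
have [cac|/incomplete_sides[u [v [uA vB nuv]]]] := boolP (complete_sides a c b); last first.
  exact: (colorable_on_mixed nac nab ncb uA vB nuv).
have [cbc|/incomplete_sides[u [v [uA vB nuv]]]] := boolP (complete_sides b c a); last first.
  exact: (colorable_on_mixed nbc nba nca uA vB nuv).
have hABC := clique_bound (complete_clique3 nab nac nbc cab cac cbc).
have cABC := colorable_on_card eirr (priv e b c :\ a :|: priv e a c :\ b :|: priv e a b :\ c).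
have habc := colorable_on_triple nab nac nbc.
have hD : colorable_on e (duo e a b c) w.-1.
  apply: (colorable_onW (colorable_on_common' nab)) => //.
  by apply/subsetP=> x /duoP[xa xb _]; rewrite inE xa.
have := colorable_onU (colorable_onU habc cABC)
  (colorable_onU hD (colorable_onU (colorable_on_common' nac) (colorable_on_common' nbc))).
move/colorable_onW; apply; first exact: triple_cover1.
have := top_duo_lt a b c; move: hABC; card_lia.
Qed.


End ManyPairs.

Lemma chromatic_bound a b c : na a b -> na a c -> na b c ->
  colorable_on e [set: T] (4 * w).
Proof.
move=> nab nac nbc.
(* The threshold 2 is the reserve left by [colorable_on_few_pairs]. *)
have [/existsP[[[x y] z] /andP[/and3P[nxy nxz nyz] few]]|many] :=
    boolP [exists t : T * T * T, [&& na t.1.1 t.1.2, na t.1.1 t.2 & na t.1.2 t.2]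
      && (npairs e (duo e t.1.1 t.1.2 t.2) <= 2)].
  apply: (colorable_onW (colorable_on_few_pairs nxy nxz nyz)) => //.
  have := top_duo_lt x y z; move: few => /=; card_lia.
apply: (colorable_on_many_pairs _ nab nac nbc) => x y z nxy nxz nyz.
rewrite ltnNge; apply: contra many => few; apply/existsP; exists (x, y, z).
by rewrite /= nxy nxz nyz few.
Qed.

End Matching.

(** * From forbidden induced subgraphs to the case distinction *)

Section Assembly.
Variables (T : finType) (e : rel T).
Hypotheses (esym : symmetric e) (eirr : irreflexive e).
Hypotheses (no4K1 : ~ has_induced fourK1 e) (noH : ~ has_induced coP3uP2 e).
Local Notation na := (compl_graph e).
Local Notation w := (clique_number e).

Lemma fourK1_free x y z t :
  na x y -> na x z -> na x t -> na y z -> na y t -> na z t -> False.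
Proof.
rewrite /compl_graph => /andP[xy nxy] /andP[xz nxz] /andP[xt nxt] /andP[yz nyz].
move=> /andP[yt nyt] /andP[zt nzt]; apply: no4K1.
exists (fun i : 'I_4 => nth x [:: x; y; z; t] i); split=> [i j /eqP|].
  by rewrite nth_uniq //= => [/eqP/val_inj//|]; rewrite !inE !negb_or xy xz xt yz yt zt.
move=> [[|[|[|[|i]]]] ?] [[|[|[|[|j]]]] ?] //=; rewrite ?eirr //; apply/negbTE => //;
  by rewrite esym.
Qed.

Lemma coP3uP2_pattern a b x y z : na a b ->
  e x a -> e x b -> e y a -> e y b -> e z a -> e z b -> e y z -> na x y -> e x z.
Proof.
move=> /andP[ab nab] xa xb ya yb za zb yz /andP[xy nxy]; apply: contraT => nxz.
have neq s t : e s t -> s != t by apply: contraTneq => ->; rewrite eirr.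
have xz : x != z by apply: contraTneq yz => <-; rewrite esym.
have yx : y != x by rewrite eq_sym.
(* The order follows [P3uP2]: the path 0 - 1 - 2 has [x] in the middle, and the edge 3 - 4 is
   [a b]. *)
case: noH; exists (fun i : 'I_5 => nth x [:: y; x; z; a; b] i); split=> [i j /eqP|].
  by rewrite nth_uniq //= => [/eqP/val_inj//|]; rewrite !inE !negb_or yx ab xz !neq.
have [ex ey ez] : [/\ e a x, e a y & e a z] by rewrite !(esym a).
have [fx fy fz] : [/\ e b x, e b y & e b z] by rewrite !(esym b).
have [zy nyx nzx nba] : [/\ e z y, ~~ e y x, ~~ e z x & ~~ e b a].
  by rewrite [e z y]esym [e y x]esym [e z x]esym [e b a]esym.
move=> [[|[|[|[|[|i]]]]] ?] [[|[|[|[|[|j]]]]] ?] //=; rewrite ?eirr //;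
  exact/negbTE.
Qed.

Lemma bounds : #|T| <= 7 * w /\ colorable_on e [set: T] (4 * w).
Proof.
have [/existsP[[[a b] c] /= /and3P[nab nac nbc]]|noT] :=
    boolP [exists t : T * T * T, [&& na t.1.1 t.1.2, na t.1.1 t.2 & na t.1.2 t.2]];
  last first.
  have alpha2 x y z : na x y -> na x z -> na y z -> False.
    move=> nxy nxz nyz; move/existsP: noT; apply.
    by exists (x, y, z); rewrite /= nxy nxz.
  have [/existsP[[a b] /= nab]|noP] := boolP [exists t : T * T, na t.1 t.2].
    exact: (alpha2_bounds esym eirr coP3uP2_pattern nab alpha2).
  have cT : #|[set: T]| <= w.
    apply: clique_bound; apply/cliqueP=> x y _ _ xy; apply: contraT => nxy.
    by move/existsP: noP; case; exists (x, y); rewrite /= /compl_graph xy.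
  split; first by move: cT; rewrite cardsT; card_lia.
  by apply: (colorable_onW (colorable_on_card eirr [set: T])) => //; move: cT; card_lia.
have [/existsP[[[[[x y] z] s] t]]|noK] := boolP [exists f : T * T * T * T * T,
    let: (x, y, z, s, t) := f in [&& [&& na x y, na x z & na y z], na s t,
      s \in trio e x y z & t \in trio e x y z]].
  case/and4P=> /and3P[nxy nxz nyz] nst sT tT.
  exact: (K23_bounds esym eirr fourK1_free coP3uP2_pattern nxy nxz nyz sT tT nst).
(* Two distinct non-neighbours [y], [z] of [x] give the forbidden graph if adjacent, and otherwise
   an independent triple complete to [a'], [b'], against [noK]. *)
have matching a' b' x y z : na a' b' -> e x a' -> e x b' -> e y a' -> e y b' ->
    e z a' -> e z b' -> na x y -> na x z -> y = z.
  move=> nab' xa xb ya yb za zb nxy nxz; apply/eqP; apply: contraT => yz.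
  have [eyz|nyz] := boolP (e y z).
    have := coP3uP2_pattern nab' xa xb ya yb za zb eyz nxy.
    by case/andP: nxz => _ /negPf->.
  case/existsP: noK; exists (x, y, z, a', b').
  rewrite nxy nxz nab' /compl_graph yz nyz !inE /=.
  by rewrite !(esym a') !(esym b') xa xb ya yb za zb.
split; first exact: (card_bound esym eirr fourK1_free matching nab nac nbc).
exact: (chromatic_bound esym eirr fourK1_free matching nab nac nbc).
Qed.

End Assembly.

Theorem theorem1p4 (T : finType) (e : rel T) :
  simple_graph e ->
  ~ has_induced fourK1 e ->
  ~ has_induced coP3uP2 e ->
  #|T| <= 7 * clique_number e /\ chromatic_number e <= 4 * clique_number e.
Proof.
move=> [esym eirr] no4K1 noH; have [nT cT] := bounds esym eirr no4K1 noH.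
by split=> //; apply: chromatic_number_le.
Qed.
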